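(* Let $\alpha\geq-\frac12$. For $n\in\mathbb{N}=\{0,1,2,\dots\}$ consider the functions $$\phi_n^\alpha(q)=\frac{q^n}{\sqrt{\beta_n(\alpha)}},\qquad q\in\mathbb{H}.$$ Then $\{\phi_n^\alpha\}_n$ forms an orthonormal basis of the slice Cholewinski-Fock space $\mathcal{F}^{\alpha}_{Slice}(\mathbb{H})$.
   Context: $\mathbb{H}$ is the skew field of quaternions, $\mathbb{S}=\{q\in\mathbb{H}: q^2=-1\}$, and $\mathbb{C}_I=\mathbb{R}+\mathbb{R}I$ for $I\in\mathbb{S}$. A function $f:\mathbb{H}\to\mathbb{H}$ is entire slice (left) regular if it is real differentiable and, for every $I\in\mathbb{S}$, its restriction $f_I$ to $\mathbb{C}_I$ has continuous partial derivatives and satisfies $\frac12(\partial_x+I\partial_y)f_I(x+yI)=0$; equivalently $f(q)=\sum_{n\ge 0}q^na_n$ with $a_n\in\mathbb{H}$, converging on all of $\mathbb{H}$. Put $f^e(q)=\frac{f(q)+f(-q)}2$, $f^o(q)=\frac{f(q)-f(-q)}2$. Let $\mathrm{Mac}_\alpha(x)=\int_0^\infty e^{-x\cosh t}\cosh(\alpha t)\,dt$ ($x>0$) be the Macdonald function and, for $I\in\mathbb{S}$, on $\mathbb{C}_I$ with Lebesgue measure $d\lambda_I$, let $$d\lambda_{\alpha,I}(p)=\frac{|p|^{2\alpha+2}}{\pi 2^\alpha\Gamma(\alpha+1)}\mathrm{Mac}_\alpha(|p|^2)\,d\lambda_I(p).$$ $\mathcal{F}^{\alpha}_{Slice}(\mathbb{H})$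 is the right quaternionic Hilbert space of entire slice regular $f$ such that, for $I\in\mathbb{S}$ (the choice of $I$ is immaterial), $$\int_{\mathbb{C}_I}|f^e_I|^2d\lambda_{\alpha,I}+2(\alpha+1)\int_{\mathbb{C}_I}|f^o_I(p)|^2|p|^{-2}d\lambda_{\alpha+1,I}(p)<\infty,$$ with inner product $$\langle f,g\rangle=\int_{\mathbb{C}_I}\overline{g^e_I}f^e_I\,d\lambda_{\alpha,I}+2(\alpha+1)\int_{\mathbb{C}_I}\overline{g^o_I(p)}f^o_I(p)|p|^{-2}d\lambda_{\alpha+1,I}(p).$$ $\beta_n(\alpha)=2^n\left[\frac n2\right]!\,\frac{\Gamma\left(\left[\frac{n+1}{2}\right]+\alpha+1\right)}{\Gamma(\alpha+1)}$, where $[\cdot]$ is the integer part. *)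

(* Defs.v *)
From HB Require Import structures.
From mathcomp Require Import all_boot all_order all_algebra.
From mathcomp Require Import ring lra.
From mathcomp Require Import all_classical all_reals all_analysis.
Set Implicit Arguments.
Unset Strict Implicit.
Unset Printing Implicit Defensive.
Import Order.TTheory GRing.Theory Num.Theory.
Import numFieldNormedType.Exports.
Local Open Scope classical_set_scope.
Local Open Scope ring_scope.

Record quat (R : Type) := Quat { q_re : R; q_i : R; q_j : R; q_k : R }.

Definition tuple_of_quat (R : Type) (q : quat R) : R * R * R * R :=
  (q_re q, q_i q, q_j q, q_k q).
Definition quat_of_tuple (R : Type) (t : R * R * R * R) : quat R :=
  let: (a, b, c, d) := t in Quat a b c d.
Lemma tuple_of_quatK (R : Type) :
  cancel (@tuple_of_quat R) (@quat_of_tuple R).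
Proof. by case. Qed.

Lemma quat_eq (R : Type) (p q : quat R) :
  q_re p = q_re q -> q_i p = q_i q -> q_j p = q_j q -> q_k p = q_k q -> p = q.
Proof. by case: p => a b c d; case: q => a' b' c' d' /= -> -> -> ->. Qed.

HB.instance Definition _ (R : choiceType) :=
  Choice.copy (quat R) (can_type (@tuple_of_quatK R)).

Section quat_algebra.
Variable R : realType.
Implicit Types (p q : quat R) (a : R).

Definition quat_add p q :=
  Quat (q_re p + q_re q) (q_i p + q_i q) (q_j p + q_j q) (q_k p + q_k q).
Definition quat_opp p := Quat (- q_re p) (- q_i p) (- q_j p) (- q_k p).
Definition quat_zero : quat R := Quat 0 0 0 0.
Definition quat_one : quat R := Quat 1 0 0 0.
Definition quat_scale a p :=
  Quat (a * q_re p) (a * q_i p) (a * q_j p) (a * q_k p).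
Definition quat_mul p q :=
  Quat (q_re p * q_re q - q_i p * q_i q - q_j p * q_j q - q_k p * q_k q)
       (q_re p * q_i q + q_i p * q_re q + q_j p * q_k q - q_k p * q_j q)
       (q_re p * q_j q - q_i p * q_k q + q_j p * q_re q + q_k p * q_i q)
       (q_re p * q_k q + q_i p * q_j q - q_j p * q_i q + q_k p * q_re q).
Definition quat_conj p := Quat (q_re p) (- q_i p) (- q_j p) (- q_k p).
Definition quat_norm p :=
  Num.sqrt (q_re p ^+ 2 + q_i p ^+ 2 + q_j p ^+ 2 + q_k p ^+ 2).

Fact quat_addA : associative quat_add.
Proof. by move=> p q r; apply: quat_eq => /=; ring. Qed.
Fact quat_addC : commutative quat_add.
Proof. by move=> p q; apply: quat_eq => /=; ring. Qed.
Fact quat_add0 : left_id quat_zero quat_add.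
Proof. by move=> p; apply: quat_eq => /=; ring. Qed.
Fact quat_addN : left_inverse quat_zero quat_opp quat_add.
Proof. by move=> p; apply: quat_eq => /=; ring. Qed.

HB.instance Definition _ :=
  GRing.isZmodule.Build (quat R) quat_addA quat_addC quat_add0 quat_addN.

Fact quat_mulA : associative quat_mul.
Proof. by move=> p q r; apply: quat_eq => /=; ring. Qed.
Fact quat_mul1 : left_id quat_one quat_mul.
Proof. by move=> p; apply: quat_eq => /=; ring. Qed.
Fact quat_mulx1 : right_id quat_one quat_mul.
Proof. by move=> p; apply: quat_eq => /=; ring. Qed.
Fact quat_mulDl : left_distributive quat_mul (@GRing.add (quat R)).
Proof. by move=> p q r; apply: quat_eq => /=; ring. Qed.
Fact quat_mulDr : right_distributive quat_mul (@GRing.add (quat R)).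
Proof. by move=> p q r; apply: quat_eq => /=; ring. Qed.
Fact quat_one_neq0 : quat_one != 0 :> quat R.
Proof. by apply/eqP => -[] /eqP; rewrite oner_eq0. Qed.

HB.instance Definition _ := GRing.Zmodule_isNzRing.Build (quat R)
  quat_mulA quat_mul1 quat_mulx1 quat_mulDl quat_mulDr quat_one_neq0.

Fact quat_scaleA a b p : quat_scale a (quat_scale b p) = quat_scale (a * b) p.
Proof. by apply: quat_eq => /=; ring. Qed.
Fact quat_scale1 : left_id 1 quat_scale.
Proof. by move=> p; apply: quat_eq => /=; ring. Qed.
Fact quat_scaleDr : right_distributive quat_scale +%R.
Proof. by move=> a p q; apply: quat_eq => /=; ring. Qed.
Fact quat_scaleDl p : {morph quat_scale^~ p : a b / a + b}.
Proof. by move=> a b; apply: quat_eq => /=; ring. Qed.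

HB.instance Definition _ := GRing.Zmodule_isLmodule.Build R (quat R)
  quat_scaleA quat_scale1 quat_scaleDr quat_scaleDl.

Fact quat_scaleAl a p q : a *: (p * q) = (a *: p) * q.
Proof. by apply: quat_eq => /=; ring. Qed.
Fact quat_scaleAr a p q : a *: (p * q) = p * (a *: q).
Proof. by apply: quat_eq => /=; ring. Qed.

HB.instance Definition _ := GRing.Lmodule_isLalgebra.Build R (quat R)
  quat_scaleAl.
HB.instance Definition _ := GRing.Lalgebra_isAlgebra.Build R (quat R)
  quat_scaleAr.

Fact ler_quat_normD p q : quat_norm (p + q) <= quat_norm p + quat_norm q.
Proof.
rewrite /quat_norm -[X in _ <= X]ger0_norm ?addr_ge0 ?sqrtr_ge0// -sqrtr_sqr.
rewrite ler_sqrt ?sqr_ge0//= [X in _ <= X]sqrrD.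
case: p => a b c d; case: q => a' b' c' d' /=.
set S := a ^+ 2 + b ^+ 2 + c ^+ 2 + d ^+ 2.
set S' := a' ^+ 2 + b' ^+ 2 + c' ^+ 2 + d' ^+ 2.
have S0 : 0 <= S by rewrite /S !addr_ge0 ?sqr_ge0.
have S'0 : 0 <= S' by rewrite /S' !addr_ge0 ?sqr_ge0.
rewrite !sqr_sqrtr// -sqrtrM//.
have : a * a' + b * b' + c * c' + d * d' <= Num.sqrt (S * S').
  apply: le_trans (ler_norm _) _.
  rewrite -sqrtr_sqr ler_sqrt ?mulr_ge0// -subr_ge0.
  have -> : S * S' - (a * a' + b * b' + c * c' + d * d') ^+ 2 =
    (a * b' - b * a') ^+ 2 + (a * c' - c * a') ^+ 2 + (a * d' - d * a') ^+ 2
    + (b * c' - c * b') ^+ 2 + (b * d' - d * b') ^+ 2 + (c * d' - d * c') ^+ 2.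
    by rewrite /S /S'; ring.
  by rewrite !addr_ge0 ?sqr_ge0.
rewrite -subr_ge0 => h; rewrite -subr_ge0.
have -> : S + Num.sqrt (S * S') *+ 2 + S' - ((a + a') ^+ 2 + (b + b') ^+ 2 +
    (c + c') ^+ 2 + (d + d') ^+ 2) =
    (Num.sqrt (S * S') - (a * a' + b * b' + c * c' + d * d')) *+ 2.
  by rewrite /S /S'; ring.
by rewrite mulrn_wge0.
Qed.

Fact quat_normZ a p : quat_norm (a *: p) = `|a| * quat_norm p.
Proof.
by rewrite /quat_norm /= !exprMn -!mulrDr sqrtrM ?sqr_ge0// sqrtr_sqr.
Qed.

Fact quat_norm0_eq0 p : quat_norm p = 0 -> p = 0.
Proof.
rewrite /quat_norm => /eqP; rewrite sqrtr_eq0 => h.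
have := sqr_ge0 (q_re p); have := sqr_ge0 (q_i p).
have := sqr_ge0 (q_j p); have := sqr_ge0 (q_k p).
move=> h1 h2 h3 h4.
by apply: quat_eq => /=; apply/eqP; rewrite -sqrf_eq0; apply/eqP; lra.
Qed.

HB.instance Definition _ := Lmodule_isNormed.Build R (quat R)
  ler_quat_normD quat_normZ quat_norm0_eq0.

End quat_algebra.

Section slice.
Variable R : realType.
Implicit Types (I q : quat R) (f g : quat R -> quat R) (alpha : R).

Definition imag_sphere : set (quat R) := [set q | q ^+ 2 = -1].

Definition slice I (p : R * R) : quat R := p.1%:A + p.2 *: I.

Definition restrict_slice I f : R * R -> quat R := f \o slice I.

Definition slice_regular f :=
  (forall q, differentiable f q) /\
  forall I, imag_sphere I ->
    let fI := restrict_slice I f in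
    [/\ forall p v, (v = (1, 0) \/ v = (0, 1)) -> derivable fI p v,
        continuous (fun p => 'D_(1, 0) fI p),
        continuous (fun p => 'D_(0, 1) fI p) &
        forall p, 2^-1 *: ('D_(1, 0) fI p + I * 'D_(0, 1) fI p) = 0].

Definition even_part f q : quat R := 2^-1 *: (f q + f (- q)).
Definition odd_part f q : quat R := 2^-1 *: (f q - f (- q)).

Definition Gamma (z : R) : R :=
  \int[lebesgue_measure]_(t in `]0, +oo[) (t `^ (z - 1) * expR (- t)).

Definition cosh (t : R) : R := (expR t + expR (- t)) / 2.

Definition macdonald alpha (x : R) : R :=
  \int[lebesgue_measure]_(t in `]0, +oo[)
    (expR (- (x * cosh t)) * cosh (alpha * t)).

(* The value at [q = 0], where [macdonald alpha] is [fine +oo = 0] instead of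
   infinite, is irrelevant: the density is only integrated over slices. *)
Definition fock_density alpha q : R :=
  `|q| `^ (2 * alpha + 2) / (pi * 2 `^ alpha * Gamma (alpha + 1))
  * macdonald alpha (`|q| ^+ 2).

(* Integral over C_I against lambda_{alpha, I}; Lebesgue measure on C_I is that
   of the plane through the coordinates (x, y) |-> x + y I. *)
Definition slice_integral alpha I (F : quat R -> R) : \bar R :=
  (\int[(@lebesgue_measure R) \x (@lebesgue_measure R)]_p
     (fock_density alpha (slice I p) * F (slice I p))%:E)%E.

(* Integral of a quaternion-valued function over C_I against
   lambda_{alpha, I}, componentwise. *)
Definition slice_qintegral alpha I (F : quat R -> quat R) : quat R :=
  let J (c : quat R -> R) := fine (slice_integral alpha I (c \o F)) in
  Quat (J (@q_re R)) (J (@q_i R)) (J (@q_j R)) (J (@q_k R)).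

Definition fock_energy alpha I f : \bar R :=
  (slice_integral alpha I (fun p => `|even_part f p| ^+ 2)%R
   + (2 * (alpha + 1))%:E *
     slice_integral (alpha + 1) I
       (fun p => `|odd_part f p| ^+ 2 * `|p| ^- 2)%R)%E.

Definition slice_fock alpha I : set (quat R -> quat R) :=
  [set f | slice_regular f /\ (fock_energy alpha I f < +oo)%E].

Definition fock_inner alpha I f g : quat R :=
  slice_qintegral alpha I (fun p => quat_conj (even_part g p) * even_part f p)
  + (2 * (alpha + 1)) *: slice_qintegral (alpha + 1) I
      (fun p => `|p| ^- 2 *: (quat_conj (odd_part g p) * odd_part f p)).

Definition beta_coef alpha (n : nat) : R :=
  2 ^+ n * ((n %/ 2)`!)%:R * Gamma ((n.+1 %/ 2)%:R + alpha + 1)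
  / Gamma (alpha + 1).

Definition fock_phi alpha (n : nat) q : quat R :=
  (Num.sqrt (beta_coef alpha n))^-1 *: q ^+ n.

(* Orthonormal family whose right quaternionic linear span is dense in [V] for
   the norm of [ip]; [ip f g] is right linear in [f]. *)
Definition orthonormal_basis (V : set (quat R -> quat R))
    (ip : (quat R -> quat R) -> (quat R -> quat R) -> quat R)
    (e : nat -> quat R -> quat R) :=
  [/\ forall n, V (e n),
      forall m n, ip (e m) (e n) = (m == n)%:R &
      forall f, V f -> forall eps : R, 0 < eps ->
        exists (N : nat) (a : nat -> quat R),
          let g := fun q => f q - \sum_(n < N) e n q * a n in
          Num.sqrt (q_re (ip g g)) < eps].

End slice.

(* Main.v *)
Require Import Defs.
From HB Require Import structures.
From mathcomp Require Import all_boot all_order all_algebra.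
From mathcomp Require Import ring lra.
From mathcomp Require Import all_classical all_reals all_analysis.
From mathcomp Require Import measurable_realfun.
Import Order.TTheory GRing.Theory Num.Theory.
Import numFieldNormedType.Exports.
Set Implicit Arguments.
Unset Strict Implicit.
Unset Printing Implicit Defensive.
Local Open Scope classical_set_scope.
Local Open Scope ring_scope.

(* The monomials q^n are orthogonal because both densities are invariant under
   the rotations p |-> e^(It) p of C_I, which multiply p^n by the phase e^(Int).
   Their norms reduce to the moments of the Macdonald density, computed by
   Tonelli after substituting s = e^tau in Gamma(a) Gamma(b).  Completeness:
   on C_I a slice regular f is the locally uniform sum of a power series
   sum p^n a_n.  Averaging f over N-th roots of unity extracts the coefficients,
   so Fatou's lemma gives Bessel's inequality
   sum |a_n|^2 beta_n <= ||f||^2; since this series converges, Fatou's lemma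
   applied to the tails shows that the partial sums tend to f in norm. *)

(** * Quaternions and finite Fourier analysis on a slice *)

(** Neither contour integrals nor polar coordinates occur: circles are replaced by orbits of N-th
    roots of unity, on which orthogonality, Parseval's identity and Bessel's inequality are exact
    finite statements. They integrate against any rotation-invariant weight. The obstacle is that
    slice regularity only provides continuous first derivatives. The power series comes from a
    discrete Cauchy formula: the polynomial interpolating f at the points r e^(2 pi I k / N) differs
    from f by an amount that a telescoping sum around closed polygons bounds by the modulus of
    continuity of the derivative. Values are quaternions, so phases act on the left and coefficients
    stay on the right; commutation is available only inside C_I. The even and the odd part carry
    different weights, both rotation-invariant, so one argument with an abstract weight serves both.
    [beta_coef] is the moment of |p|^(2n) under the weight of the parity of n; the factor 2 (alpha +
    1) and the shift to alpha + 1 are what makes the odd moments fit. *)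

Section quaternions.
Variable R : realType.
Implicit Types (p q u : quat R) (a x y : R).

Lemma quat_normE q : `|q| = Num.sqrt (q_re q ^+ 2 + q_i q ^+ 2 + q_j q ^+ 2 + q_k q ^+ 2).
Proof. by []. Qed.

Lemma sqr_quat_norm q :
  `|q| ^+ 2 = q_re q ^+ 2 + q_i q ^+ 2 + q_j q ^+ 2 + q_k q ^+ 2.
Proof. by rewrite quat_normE sqr_sqrtr// !addr_ge0 ?sqr_ge0. Qed.

Lemma quat_normM p q : `|p * q| = `|p| * `|q|.
Proof.
apply/eqP; rewrite -(@eqrXn2 _ 2)// ?mulr_ge0// exprMn !sqr_quat_norm /=.
by apply/eqP; ring.
Qed.

Lemma quat_norm1 : `|1 : quat R| = 1.
Proof. by rewrite quat_normE /= expr1n expr0n /= !addr0 sqrtr1. Qed.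

Lemma quat_normX q n : `|q ^+ n| = `|q| ^+ n.
Proof.
by elim: n => [|n IH]; rewrite ?expr0 ?quat_norm1// !exprS quat_normM IH.
Qed.

Lemma quat_mul_eq0 p q : p * q = 0 -> p = 0 \/ q = 0.
Proof.
move=> /(congr1 (fun q => `|q|)) /eqP.
rewrite quat_normM normr0 mulf_eq0 => /orP[] /eqP /normr0_eq0; tauto.
Qed.

Lemma quat_conjM p q : quat_conj (p * q) = quat_conj q * quat_conj p.
Proof. by apply: quat_eq => /=; ring. Qed.

Lemma quat_conj_mul q : quat_conj q * q = (`|q| ^+ 2)%:A.
Proof. by rewrite sqr_quat_norm; apply: quat_eq => /=; ring. Qed.

Lemma quat_norm_conj q : `|quat_conj q| = `|q|.
Proof. by rewrite !quat_normE /= !sqrrN. Qed.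

Lemma normr_re_le q : `|q_re q| <= `|q|.
Proof.
rewrite -(@ler_pXn2r _ 2)// ?nnegrE// sqr_quat_norm real_normK ?num_real//.
by rewrite -!addrA lerDl !addr_ge0 ?sqr_ge0.
Qed.

End quaternions.

Section slice_lemmas.
Variables (R : realType) (I : quat R).
Hypothesis hI : imag_sphere I.
Implicit Types (p v : R * R) (t : R).

(** The imaginary components of I^2 are 2 [q_re I] times those of I. If [q_re I] were nonzero, I
    would be real with a nonnegative square. *)
Lemma imag_sphereP :
  q_re I = 0 /\ q_i I ^+ 2 + q_j I ^+ 2 + q_k I ^+ 2 = 1.
Proof.
have [] : q_re (I ^+ 2) = -1 /\ [/\ q_i (I ^+ 2) = 0, q_j (I ^+ 2) = 0 & q_k (I ^+ 2) = 0].
  have -> : I ^+ 2 = -1 by exact: hI.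
  by rewrite /= !oppr0.
rewrite expr2 /= => h1 [h2 h3 h4].
have re0 : q_re I = 0.
  apply/eqP/negPn/negP => r0.
  have i0 c : q_re I * c + c * q_re I = 0 -> c = 0.
    rewrite [c * _]mulrC -mulr2n => /eqP.
    by rewrite mulrn_eq0/= mulf_eq0 (negbTE r0)/= => /eqP.
  have e2 : q_i I = 0 by apply: i0; lra.
  have e3 : q_j I = 0 by apply: i0; lra.
  have e4 : q_k I = 0 by apply: i0; lra.
  have := sqr_ge0 (q_re I); rewrite expr2; move: h1; rewrite e2 e3 e4; lra.
split => //; move: h1; rewrite re0 !expr2; lra.
Qed.

Lemma sqr_imag_sphere : I * I = -1.
Proof. by rewrite -expr2; exact: hI. Qed.

Lemma sliceD p v : slice I (p + v) = slice I p + slice I v.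
Proof. by rewrite /slice /= !scalerDl addrACA. Qed.

Lemma sliceN p : slice I (- p) = - slice I p.
Proof. by rewrite /slice /= !scaleNr opprD. Qed.

Lemma sliceB p v : slice I (p - v) = slice I p - slice I v.
Proof. by rewrite sliceD sliceN. Qed.

Lemma sliceZ t p : slice I (t *: p) = t *: slice I p.
Proof. by rewrite /slice /= -!scalerA -scalerDr. Qed.

Lemma sqr_norm_slice p : `|slice I p| ^+ 2 = p.1 ^+ 2 + p.2 ^+ 2.
Proof.
have [re0 n1] := imag_sphereP.
rewrite sqr_quat_norm /slice /= re0.
transitivity (p.1 ^+ 2 + p.2 ^+ 2 * (q_i I ^+ 2 + q_j I ^+ 2 + q_k I ^+ 2)).
  by ring.
by rewrite n1 mulr1.
Qed.

(** Complex multiplication in coordinates, kept on R * R because the Lebesgue measure lives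
    there. *)
Definition cmul p v : R * R :=
  (p.1 * v.1 - p.2 * v.2, p.1 * v.2 + p.2 * v.1).

Lemma slice_cmul p v : slice I (cmul p v) = slice I p * slice I v.
Proof.
rewrite /slice /cmul /= !(mulrDl, mulrDr) -!(scalerAl, scalerAr).
rewrite !(mulr1, mul1r) sqr_imag_sphere !scalerA scalerN !scalerDl scaleNr.
rewrite -!addrA; congr (_ + _); rewrite [RHS]addrA [RHS]addrC.
by congr (_ + _); rewrite addrC.
Qed.

Lemma slice_comm p v : slice I p * slice I v = slice I v * slice I p.
Proof.
rewrite -!slice_cmul; congr slice.
by rewrite /cmul; congr (_, _); ring.
Qed.

(** This is e^(It). The rotation [rotp] below is multiplication by it, read in coordinates, so that
    it does not involve I. *)
Definition expI t : quat R := slice I (cos t, sin t).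
Definition rotp t p : R * R := cmul (cos t, sin t) p.

Lemma slice_rot t p : slice I (rotp t p) = expI t * slice I p.
Proof. exact: slice_cmul. Qed.

Lemma expI0 : expI 0 = 1.
Proof. by rewrite /expI cos0 sin0 /slice/= scale1r scale0r addr0. Qed.

Lemma expID s t : expI (s + t) = expI s * expI t.
Proof.
rewrite /expI -slice_cmul; congr slice.
by rewrite /cmul /= cosD sinD; congr (_, _); ring.
Qed.

Lemma expI_norm t : `|expI t| = 1.
Proof.
apply/eqP; rewrite -(@eqrXn2 _ 2)// sqr_norm_slice/=.
by rewrite cos2Dsin2 expr1n.
Qed.

Lemma expIM n t : expI t ^+ n = expI (n%:R * t).
Proof.
elim: n => [|n IH]; first by rewrite mul0r expI0.
by rewrite exprS IH -expID -addn1 natrD mulrDl mul1r addrC.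
Qed.

Lemma norm_rot t p : `|slice I (rotp t p)| = `|slice I p|.
Proof. by rewrite slice_rot quat_normM expI_norm mul1r. Qed.

Lemma conj_expI t : quat_conj (expI t) = expI (- t).
Proof.
have [re0 _] := imag_sphereP.
by rewrite /expI cosN sinN; apply: quat_eq; rewrite /= ?re0; ring.
Qed.

End slice_lemmas.

Section inner_product.
Variable R : realType.
Implicit Types x y z : quat R.

(** The Euclidean inner product of R^4: real bilinear, with [quat_conj u] as the adjoint of left
    multiplication by u. *)
Definition dotq x y : R := q_re (quat_conj x * y).

Lemma dotqDl x y z : dotq (x + y) z = dotq x z + dotq y z.
Proof. by rewrite /dotq /=; ring. Qed.

Lemma dotqDr x y z : dotq x (y + z) = dotq x y + dotq x z.
Proof. by rewrite /dotq /=; ring. Qed.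

Lemma dotq0l x : dotq 0 x = 0.
Proof. by rewrite /dotq /=; ring. Qed.

Lemma dotq0r x : dotq x 0 = 0.
Proof. by rewrite /dotq /=; ring. Qed.

Lemma dotqZr a x y : dotq x (a *: y) = a * dotq x y.
Proof. by rewrite /dotq /=; ring. Qed.

Lemma dotq_suml (J : Type) (s : seq J) (F : J -> quat R) y :
  dotq (\sum_(j <- s) F j) y = \sum_(j <- s) dotq (F j) y.
Proof. by apply: (big_morph (dotq^~ y) (fun a b => dotqDl a b y) (dotq0l y)). Qed.

Lemma dotq_sumr (J : Type) (s : seq J) (F : J -> quat R) x :
  dotq x (\sum_(j <- s) F j) = \sum_(j <- s) dotq x (F j).
Proof. by apply: (big_morph (dotq x) (dotqDr x) (dotq0r x)). Qed.

Lemma dotqq x : dotq x x = `|x| ^+ 2.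
Proof. by rewrite /dotq quat_conj_mul /=; ring. Qed.

Lemma dotq_mull u x y : dotq (u * x) y = dotq x (quat_conj u * y).
Proof. by rewrite /dotq /=; ring. Qed.

Lemma sqr_normB x y :
  `|x - y| ^+ 2 = `|x| ^+ 2 - 2 * dotq y x + `|y| ^+ 2.
Proof. by rewrite !sqr_quat_norm /dotq /=; ring. Qed.

End inner_product.

(** * Roots of unity in place of integration over circles *)

Section roots_of_unity.
Variables (R : realType) (I : quat R).
Hypothesis hI : imag_sphere I.
Local Notation expI := (expI I).
Implicit Types (N n m k : nat) (F : R * R -> quat R).

(** The angle between consecutive N-th roots of unity, locked so that it stays an atom in
    computations. *)
Definition rang N : R := locked (2 * pi / N%:R).

Lemma mul_rang N : (0 < N)%N -> N%:R * rang N = 2 * pi.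
Proof. by move=> N0; rewrite /rang -lock mulrC divfK// pnatr_eq0 -lt0n. Qed.

Lemma expI2pi : expI (2 * pi) = 1.
Proof.
rewrite -[LHS]/(slice I (cos (2 * pi), sin (2 * pi))) mulr_natl cos2pi sin2pi.
by rewrite /slice /= scale1r scale0r addr0.
Qed.

(** If cos t = 1, the half-angle formula and cos^2 + sin^2 = 1 force sin (t / 2) = 0, whereas t / 2
    lies strictly between 0 and pi. *)
Lemma expI_neq1 t : 0 < t < 2 * pi -> expI t != 1.
Proof.
move=> /andP[t0 t2]; apply/eqP => E.
have : cos t = 1.
  have [re0 _] := imag_sphereP hI.
  move/(congr1 (@q_re R)): E; rewrite /= re0 => <-; ring.
rewrite [t]splitr cosD => h.
have s0 : 0 < sin (t / 2) by apply: sin_gt0_pi; lra.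
have := mulr_gt0 s0 s0; have := cos2Dsin2 (t / 2); rewrite !expr2; lra.
Qed.

(** Orthogonality of characters. Off the diagonal this is a geometric sum of ratio e^(Is) different
    from 1 with e^(IsN) = 1, and quaternions have no zero divisors. *)
Lemma sum_roots N n m : (n < N)%N -> (m < N)%N ->
  \sum_(k < N) expI (k%:R * ((n%:R - m%:R) * rang N)) =
  (if n == m then N else 0)%:R.
Proof.
move=> nN mN; have N0 : (0 < N)%N by exact: leq_ltn_trans nN.
have rN : 0 < rang N.
  by rewrite /rang -lock divr_gt0 ?mulr_gt0 ?pi_gt0 ?ltr0n.
case: eqVneq => [->|nm].
  under eq_bigr do rewrite subrr mul0r mulr0 expI0.
  by rewrite sumr_const card_ord.
set s := (_ - _) * _.
have neq1 : expI s != 1.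
  have aux i j : (i < N)%N -> (j < i)%N -> expI ((i%:R - j%:R) * rang N) != 1.
    move=> iN ji; apply: expI_neq1; apply/andP; split.
      by rewrite mulr_gt0// subr_gt0 ltr_nat.
    rewrite -(mul_rang N0) ltr_pM2r// ltrBlDr -natrD ltr_nat.
    by rewrite (leq_trans iN)// leq_addr.
  (* For n < m the angle s is negative; e^(Is) = 1 would give the same for -s, which [aux]
     excludes. *)
  have [lt|gt|eq] := ltngtP n m; last by rewrite eq eqxx in nm.
    apply/eqP => E; have /eqP := aux _ _ mN lt; apply.
    rewrite -opprB mulNr -/s -[LHS]mul1r -{1}E.
    by rewrite -expID// subrr expI0.
  exact: aux.
have sN : expI s ^+ N = 1.
  have aux i : expI (i%:R * (2 * pi)) = 1 by rewrite -expIM// expI2pi expr1n.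
  rewrite expIM// /s mulrCA mul_rang// mulrBl.
  rewrite -[LHS]mulr1 -[X in _ * X](aux m) -expID//.
  by rewrite subrK aux.
under eq_bigr do rewrite -expIM//.
have : (expI s - 1) * (\sum_(k < N) expI s ^+ k) = 0.
  by rewrite -subrX1 sN subrr.
case/quat_mul_eq0 => // /eqP; rewrite subr_eq0; by rewrite (negbTE neq1).
Qed.

(** The N-point Riemann sum of (1 / 2 pi) times the integral of e^(-Int) F(e^(It) p) over a period:
    the n-th Fourier coefficient of F on the circle through p. *)
Definition avg N n F p : quat R :=
  N%:R^-1 *: \sum_(k < N) expI (- (k%:R * (n%:R * rang N))) *
    F (rotp (k%:R * rang N) p).

Lemma slice_rotX t p m : slice I (rotp t p) ^+ m = expI (m%:R * t) * slice I p ^+ m.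
Proof.
rewrite slice_rot// exprMn_comm ?expIM//.
exact: slice_comm.
Qed.

(** Exact, without aliasing: all exponents are below N, so [sum_roots] kills every term but the
    n-th. *)
Lemma avg_poly N n d (b : nat -> quat R) p : (n < N)%N -> (d <= N)%N ->
  avg N n (fun q => \sum_(m < d) slice I q ^+ m * b m) p =
  if (n < d)%N then slice I p ^+ n * b n else 0.
Proof.
move=> nN dN.
have N0 : (N%:R : R) != 0 by rewrite pnatr_eq0 -lt0n (leq_ltn_trans _ nN).
rewrite /avg.
under eq_bigr => k _.
  rewrite mulr_sumr; under eq_bigr => m _.
    rewrite slice_rotX -mulrA mulrA -expID//.
    have -> : - (k%:R * (n%:R * rang N)) + m%:R * (k%:R * rang N) =
        k%:R * ((m%:R - n%:R) * rang N) by ring.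
    over.
  over.
rewrite exchange_big/=.
under eq_bigr => m _ do rewrite -mulr_suml sum_roots ?(leq_trans (ltn_ord m) dN)//.
case: ifPn => nd.
  rewrite (bigD1 (Ordinal nd))//= big1 => [|m mn]; last first.
    by rewrite ifN ?mul0r//; apply: contra mn => /eqP/val_inj ->.
  by rewrite eqxx addr0 mulr_natl -[(_ * _) *+ N]scaler_nat scalerA mulVf// scale1r.
rewrite big1 ?scaler0// => m _.
by rewrite ifN ?mul0r//; apply: contraNN nd => /eqP <-.
Qed.

Lemma avgB N n F G p : avg N n (fun q => F q - G q) p = avg N n F p - avg N n G p.
Proof.
by rewrite /avg -scalerBr -sumrB; congr (_ *: _); apply: eq_bigr => k _; rewrite mulrBr.
Qed.

Lemma norm_avg_le N n F p (C : R) : (0 < N)%N ->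
  (forall q, `|slice I q| = `|slice I p| -> `|F q| <= C) -> `|avg N n F p| <= C.
Proof.
move=> N0 FC; rewrite /avg normrZ ger0_norm ?invr_ge0//.
rewrite mulrC ler_pdivrMr ?ltr0n// (le_trans (ler_norm_sum _ _ _))//.
apply: le_trans (_ : \sum_(k < N) C <= _); last first.
  by rewrite sumr_const card_ord mulr_natr.
apply: ler_sum => k _; rewrite quat_normM expI_norm// mul1r FC//.
exact: norm_rot.
Qed.

(** In the expanded square the two phases meet through the adjoint rule [dotq_mull], and [sum_roots]
    leaves the diagonal. *)
Lemma parseval_roots N M (c : nat -> quat R) : (M <= N)%N ->
  \sum_(k < N) `|\sum_(n < M) expI (k%:R * (n%:R * rang N)) * c n| ^+ 2 =
  N%:R * \sum_(n < M) `|c n| ^+ 2.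
Proof.
move=> MN.
under eq_bigr => k _.
  rewrite -dotqq dotq_suml.
  under eq_bigr => n _.
    rewrite dotq_sumr; under eq_bigr => m _.
      rewrite dotq_mull conj_expI// mulrA -expID//.
      have -> : - (k%:R * (n%:R * rang N)) + k%:R * (m%:R * rang N) =
        k%:R * ((m%:R - n%:R) * rang N) by ring.
      over.
    over.
  over.
rewrite exchange_big/= mulr_sumr; apply: eq_bigr => n _.
rewrite exchange_big/= (bigD1 n)//= [X in _ + X]big1 => [|m mn]; last first.
  rewrite -dotq_sumr -mulr_suml sum_roots ?(leq_trans (ltn_ord _))//.
  by rewrite ifN ?mul0r ?dotq0r//; apply: contra mn => /eqP/val_inj ->.
rewrite -dotq_sumr -mulr_suml sum_roots ?(leq_trans (ltn_ord _))//.
by rewrite eqxx addr0 mulr_natl -scaler_nat dotqZr dotqq.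
Qed.

(** The squared distance from F to its trigonometric polynomial T on the orbit is nonnegative; by
    the definition of [avg], the cross term equals the squared norm of T. *)
Lemma bessel_roots N M F p : (0 < N)%N -> (M <= N)%N ->
  \sum_(n < M) `|avg N n F p| ^+ 2 <=
  N%:R^-1 * \sum_(k < N) `|F (rotp (k%:R * rang N) p)| ^+ 2.
Proof.
move=> N0 MN; rewrite mulrC ler_pdivlMr ?ltr0n// -subr_ge0.
pose T k := \sum_(n < M) expI (k%:R * (n%:R * rang N)) * avg N n F p.
have : 0 <= \sum_(k < N) `|F (rotp (k%:R * rang N) p) - T k| ^+ 2.
  by apply: sumr_ge0 => k _; exact: sqr_ge0.
under eq_bigr do rewrite sqr_normB.
rewrite big_split/= sumrB -mulr_sumr (parseval_roots (fun n => avg N n F p))//.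
have -> : \sum_(k < N) dotq (T k) (F (rotp (k%:R * rang N) p)) =
    N%:R * \sum_(n < M) `|avg N n F p| ^+ 2.
  under eq_bigr => k _.
    rewrite dotq_suml; under eq_bigr do rewrite dotq_mull conj_expI//.
    over.
  rewrite exchange_big/= mulr_sumr; apply: eq_bigr => n _.
  rewrite -dotq_sumr -dotqq -dotqZr; congr dotq.
  by rewrite /avg scalerA divff ?scale1r// pnatr_eq0 -lt0n.
by move=> h; apply: le_trans h _; rewrite le_eqVlt; apply/orP; left; apply/eqP; ring.
Qed.

End roots_of_unity.

(** * Slice regular functions are power series on each slice *)

Lemma lipschitz_linear_continuous (R : realType) (V W : normedModType R)
    (L : V -> W) (C : R) :
  linear L -> (forall q, `|L q| <= C * `|q|) -> continuous L.
Proof.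
move=> linL LC; pose LM := GRing.isLinear.Build _ _ _ _ _ linL.
pose L' : {linear _ -> _} := HB.pack L LM.
rewrite -[L]/(L' : _ -> _).
apply/linear_bounded_continuous/linear_boundedP.
near=> r => x; apply: (le_trans (LC x)); apply: ler_wpM2r => //.
Unshelve. all: by end_near. Qed.

Lemma is_derive_linear (R : realType) (V W W' : normedModType R)
    (L : W -> W') (G : V -> W) (x v : V) (d : W) (C : R) :
  linear L -> (forall q, `|L q| <= C * `|q|) ->
  is_derive x v G d -> is_derive x v (L \o G) (L d).
Proof.
move=> linL LC [dG <-].
have cL := lipschitz_linear_continuous linL LC.
have L0 : L 0 = 0.
  by apply/eqP; rewrite -normr_le0 (le_trans (LC 0))// normr0 mulr0.
have LZ a p : L (a *: p) = a *: L p.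
  by rewrite -[a *: p]addr0 linL L0 addr0.
have LB p q : L (p - q) = L p - L q.
  by rewrite addrC -scaleN1r linL scaleN1r addrC.
have H : h^-1 *: ((L \o G \o shift x) (h *: v) - (L \o G) x) @[h --> 0^'] -->
    L ('D_v G x).
  have -> : (fun h : R => h^-1 *: ((L \o G \o shift x) (h *: v) - (L \o G) x)) =
    L \o (fun h : R => h^-1 *: ((G \o shift x) (h *: v) - G x)).
    by apply/funext => h; rewrite /= LZ LB.
  exact: cvg_comp dG (cL _).
by apply: DeriveDef; [apply/cvg_ex; exists (L ('D_v G x)) | exact/cvg_lim].
Qed.

Section bounded_linear.
Variable R : realType.

Lemma quat_mull_linear (u : quat R) : linear (fun q => u * q).
Proof. by move=> a p q; rewrite mulrDr scalerAr. Qed.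

Lemma quat_mull_bounded (u q : quat R) : `|u * q| <= `|u| * `|q|.
Proof. by rewrite quat_normM. Qed.

Lemma slice_linear (I : quat R) : linear (slice I).
Proof. by move=> a p q; rewrite sliceD sliceZ. Qed.

Lemma slice_bounded (I : quat R) p : `|slice I p| <= (1 + `|I|) * `|p|.
Proof.
rewrite /slice (le_trans (ler_normD _ _))// !normrZ quat_norm1 mulr1.
rewrite mulrDl mul1r lerD//; first by rewrite prod_normE le_max lexx.
by rewrite mulrC ler_wpM2l// prod_normE le_max lexx orbT.
Qed.

End bounded_linear.

(** The real mean value theorem is applied to the component of G along u = G 1 - G 0, for which
    |u|^2 = [L (dG c)] is at most |u| C. *)
Lemma mean_value_inequality (R : realType) (G dG : R -> quat R) (C : R) :
  (forall t : R, is_derive t (1 : R) G (dG t)) ->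
  (forall t, 0 < t < 1 -> `|dG t| <= C) -> `|G 1 - G 0| <= C.
Proof.
move=> dGE dGC; set u := G 1 - G 0.
pose L q : R := q_re (quat_conj u * q).
have linL : linear L.
  by move=> a p q; rewrite /L/= /GRing.scale/=; ring.
have LC q : `|L q| <= `|u| * `|q|.
  by rewrite (le_trans (normr_re_le _))// quat_normM quat_norm_conj.
have dh (t : R) : is_derive t (1 : R) (L \o G) (L (dG t)).
  exact: is_derive_linear linL LC (dGE t).
have [c c01 E] : exists2 c : R, c \in `]0, 1[ &
    (L \o G) 1 - (L \o G) 0 = L (dG c) * (1 - 0).
  apply: MVT => //.
  by apply: derivable_within_continuous => x _; have [] := dh x.
have Lu : `|u| ^+ 2 = L (dG c).
  transitivity (L (G 1) - L (G 0)); last first.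
    by move: E => /= ->; rewrite subr0 mulr1.
  have -> : L (G 1) - L (G 0) = q_re (quat_conj u * u) by rewrite /L /u /=; ring.
  by rewrite quat_conj_mul /=; ring.
have : `|u| ^+ 2 <= `|u| * C.
  rewrite Lu (le_trans (ler_norm _))// (le_trans (LC _))//.
  by rewrite ler_wpM2l// dGC//; move: c01; rewrite in_itv.
(* When u = 0, the claim 0 <= C follows from the bound on dG at t = 1/2. *)
have [->|u0] := eqVneq u 0.
  move=> _; rewrite normr0; have := dGC 2^-1.
  by move=> h; apply: le_trans (h _) => //; lra.
by rewrite expr2 ler_pM2l ?normr_gt0.
Qed.

(** Compactness in its near-covering form: a d working near each point of the square can be chosen
    uniformly. *)
Lemma uniform_continuity_box (R : realType) (V : normedModType R)
    (D : R * R -> V) (r e : R) : continuous D -> 0 < e ->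
  exists2 d : R, 0 < d & forall p q, `|p| <= r -> `|q - p| < d ->
    `|D q - D p| <= e.
Proof.
move=> cD e0.
(* The norm of R * R is the maximum norm, so its closed balls are squares. *)
pose K : set (R * R) := [set` `[-r, r]] `*` [set` `[-r, r]].
have cK : compact K by apply: compact_setX; exact: segment_compact.
pose P (d : R) (p : R * R) := forall q, `|q - p| < d -> `|D q - D p| <= e.
have := (compact_near_coveringP K).1 cK R (0 : R)^'+ P _.
case.
  move=> x _.
  have /nbhs_normP[d /= d0 Hd] : \forall y \near x, `|D x - D y| < e / 2.
    have /cvgrPdist_lt := cD x; apply; exact: divr_gt0.
  exists (ball x (d / 2), [set t | 0 < t < d / 2]) => /=.
    split; first by apply: nbhsx_ballx; exact: divr_gt0.
    near=> t; apply/andP; split; near: t; first exact: nbhs_right_gt.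
    by apply: nbhs_right_lt; exact: divr_gt0.
  move=> [y t] [/= xy /andP[t0 td]] q qy.
  have xy' : `|x - y| < d / 2 by move: xy; rewrite -ball_normE.
  have h1 : `|D x - D y| < e / 2.
    by apply: Hd => /=; apply: lt_trans xy' _; lra.
  have h2 : `|D x - D q| < e / 2.
    apply: Hd => /=; rewrite -(subrKA y) (le_lt_trans (ler_normD _ _))//.
    by rewrite [d]splitr ltrD// distrC (lt_trans qy).
  rewrite -(subrKA (D x)) (le_trans (ler_normD _ _))// [e]splitr distrC.
  by rewrite lerD// ltW.
move=> d /= d0 Hd.
exists (d / 2); first exact: divr_gt0.
move=> p q pr; apply: (Hd (d / 2)).
- rewrite /= sub0r normrN gtr0_norm ?divr_gt0//.
  by rewrite ltr_pdivrMr// ltr_pMr// ltr1n.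
- by rewrite divr_gt0.
- split => /=; rewrite in_itv/= -ler_norml (le_trans _ pr)// prod_normE le_max lexx//.
  by rewrite orbT.
Unshelve. all: by end_near. Qed.

(** * A discrete Cauchy formula and polynomial approximation on discs *)

Section discrete_cauchy.
Variables (R : realType) (I : quat R).
Hypothesis hI : imag_sphere I.
Variables F D : R * R -> quat R.
(** D is the derivative of F in the complex sense: along every direction v, the derivative is left
    multiplication of D by v. *)
Hypothesis dF : forall p v (t : R),
  is_derive t (1 : R) (fun s => F (p + s *: v)) (slice I v * D (p + t *: v)).
Hypothesis cD : continuous D.

Lemma norm_le_slice (p : R * R) : `|p| <= `|slice I p|.
Proof.
rewrite prod_normE ge_max; apply/andP; split;
  rewrite -(@ler_pXn2r _ 2)// ?nnegrE// sqr_norm_slice// real_normK ?num_real//.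
  by rewrite lerDl sqr_ge0.
by rewrite lerDr sqr_ge0.
Qed.

(** The mean value inequality for F(p + t v) with its linear part at p subtracted. *)
Lemma chord_estimate p v (e : R) :
  (forall t : R, 0 < t < 1 -> `|D (p + t *: v) - D p| <= e) ->
  `|F (p + v) - F p - slice I v * D p| <= `|slice I v| * e.
Proof.
move=> De; pose w := slice I v * D p.
pose G (t : R) := F (p + t *: v) - t *: w.
have dG (t : R) : is_derive t (1 : R) G (slice I v * (D (p + t *: v) - D p)).
  rewrite mulrBr; apply: is_deriveB.
  have -> : slice I v * D p = 1 *: w by rewrite scale1r.
  apply: (is_derive_linear (L := fun a : R => a *: w) (G := id) (C := `|w|)).
  - by move=> a x y; rewrite scalerDl scalerA.
  - by move=> a; rewrite normrZ mulrC.
have := @mean_value_inequality _ G _ (`|slice I v| * e) dG.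
have -> : G 1 - G 0 = F (p + v) - F p - w.
  by rewrite /G !scale1r !scale0r subr0 addr0 addrAC.
apply => t t01.
by rewrite quat_normM ler_wpM2l// De.
Qed.

Variables (r : R) (r0 : 0 < r).
(** The N-th roots of unity scaled to the circle of radius r. *)
Let zk N (k : nat) : R * R := rotp (k%:R * rang R N : R) (r, 0).

Lemma slice_zk N k : slice I (zk N k) = r *: expI I (k%:R * rang R N).
Proof.
rewrite /zk slice_rot// [slice I (r, 0)]/slice /= scale0r addr0.
by rewrite -scalerAr mulr1.
Qed.

(* F telescopes to 0 around the closed polygon with vertices z + t (zk - z), and
   each chord contributes its derivative up to an error controlled by e. *)
Lemma telescoping_estimate N (z : R * R) (t e : R) : (1 < N)%N ->
  `|slice I z| <= r -> 0 < t < 1 ->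
  (forall p q, `|p| <= r -> `|q - p| <= r * `|expI I (rang R N) - 1| ->
     `|D q - D p| <= e) ->
  `|\sum_(k < N) slice I (zk N k) * D (z + t *: (zk N k - z))| <=
  N%:R * (r * e).
Proof.
move=> N1 zr /andP[t0 t1] De; have N0 : (0 < N)%N by exact: ltnW.
set w := expI I (rang R N) - 1.
(* This is where N > 1 matters: the angle then lies strictly between 0 and 2 pi. *)
have w0 : 0 < `|w|.
  rewrite normr_gt0 subr_eq0; apply: expI_neq1 => //.
  have h : 0 < rang R N by rewrite /rang -lock divr_gt0 ?mulr_gt0 ?pi_gt0 ?ltr0n.
  by rewrite h/= -(mul_rang R N0) ltr_pMl// ltr1n.
pose q k := z + t *: (zk N k - z).
have dqE k : slice I (q k.+1 - q k) = t *: (w * slice I (zk N k)).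
  have -> : q k.+1 - q k = t *: (zk N k.+1 - zk N k).
    by rewrite /q opprD addrACA subrr add0r -scalerBr opprB addrA subrK.
  rewrite sliceZ sliceB !slice_zk -natr1 [k%:R + 1]addrC mulrDl mul1r expID//.
  by rewrite /w mulrBl mul1r -scalerAr.
have ndq k : `|slice I (q k.+1 - q k)| = t * (`|w| * r).
  rewrite dqE normrZ quat_normM slice_zk normrZ expI_norm// mulr1.
  by rewrite !gtr0_norm.
have nq k : `|q k| <= r.
  apply: (le_trans (norm_le_slice _)).
  have -> : q k = (1 - t) *: z + t *: zk N k.
    by rewrite /q scalerBr scalerBl scale1r addrAC addrA.
  rewrite sliceD !sliceZ (le_trans (ler_normD _ _))// !normrZ slice_zk normrZ.
  rewrite expI_norm// mulr1 (gtr0_norm r0) (gtr0_norm t0) gtr0_norm ?subr_gt0//.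
  by have := ler_wpM2l (_ : 0 <= 1 - t) zr; rewrite subr_ge0 ltW// => /(_ isT); lra.
pose er k := F (q k.+1) - F (q k) - slice I (q k.+1 - q k) * D (q k).
have ner k : `|er k| <= t * (`|w| * r) * e.
  rewrite /er -{1}(subrK (q k) (q k.+1)) [_ + q k]addrC -[X in _ <= X * _](ndq k).
  apply: chord_estimate => s /andP[s0 s1]; apply: De => //.
  rewrite addrC addKr (le_trans (norm_le_slice _))// sliceZ normrZ ndq gtr0_norm//.
  rewrite [`|w| * r]mulrC mulrA ler_piMl ?mulr_ge0 ?ltW//.
  by apply: mulr_ilt1 => //; exact: ltW.
have S0 : \sum_(k < N) (F (q k.+1) - F (q k)) = 0.
  rewrite -(big_mkord xpredT (fun k => F (q k.+1) - F (q k))) telescope_sumr//.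
  rewrite /q /zk mul0r mul_rang//; apply/eqP; rewrite subr_eq0; apply/eqP.
  congr (F (z + t *: (_ - z))).
  by rewrite /rotp mulr_natl cos2pi sin2pi cos0 sin0.
(* Each chord is t w zk, so the main terms sum to t w times the quantity to be bounded. The chord
   lengths put the same factor t |w| in the error, and it cancels. *)
have E : t *: (w * \sum_(k < N) slice I (zk N k) * D (q k)) =
    - \sum_(k < N) er k.
  rewrite mulr_sumr scaler_sumr /er sumrB S0 sub0r opprK.
  by apply: eq_bigr => k _; rewrite dqE -scalerAl mulrA.
have := congr1 (fun x => `|x|) E; rewrite /= normrN normrZ quat_normM gtr0_norm// => E'.
have : t * (`|w| * `|\sum_(k < N) slice I (zk N k) * D (q k)|) <=
    t * (`|w| * (N%:R * (r * e))).
  rewrite E' (le_trans (ler_norm_sum _ _ _))//.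
  apply: le_trans (_ : \sum_(k < N) (t * (`|w| * r) * e) <= _).
    by apply: ler_sum => k _; exact: ner.
  rewrite sumr_const card_ord -mulr_natl le_eqVlt; apply/orP; left; apply/eqP.
  by ring.
by rewrite !ler_pM2l.
Qed.

(** The coefficient of z^n in the polynomial of degree below N that interpolates F at the points
    [zk N k]. *)
Definition interp_coef N n : quat R := (r ^+ n)^-1 *: avg I N n F (r, 0).

(* For G t = sum_k K_k F (z + t (zk - z)), with K_k = sum_(n < N) (z / zk)^n,
   G 0 is N F z and G 1 is N times the interpolating polynomial at z; since
   K_k (zk - z) = (1 - (z / r)^N) zk, the derivative of G is the sum bounded in
   telescoping_estimate. *)
Lemma interpolation_error N (z : R * R) (e : R) : (1 < N)%N ->
  `|slice I z| <= r ->
  (forall p q, `|p| <= r -> `|q - p| <= r * `|expI I (rang R N) - 1| ->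
     `|D q - D p| <= e) ->
  `|F z - \sum_(n < N) slice I z ^+ n * interp_coef N n| <= 2 * (r * e).
Proof.
move=> N1 zr De; have N0 : (0 < N)%N by exact: ltnW.
have NR0 : 0 < N%:R :> R by rewrite ltr0n.
pose s := slice I z; pose ze := r^-1 *: s.
(* This is z / zk, and [ze] is z / r. *)
pose x k := ze * expI I (- (k%:R * rang R N)).
have cz k : GRing.comm ze (expI I (- (k%:R * rang R N))).
  rewrite /GRing.comm /ze -scalerAl -scalerAr.
  by rewrite (slice_comm hI z (cos _, sin _)).
have xX k n : x k ^+ n = ze ^+ n * expI I (- (k%:R * (n%:R * rang R N))).
  rewrite /x exprMn_comm// expIM//; congr (_ * expI _ _); ring.
pose K k := \sum_(n < N) x k ^+ n.
have Kz k : K k * slice I (zk N k - z) = (1 - ze ^+ N) * slice I (zk N k).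
  have -> : slice I (zk N k - z) = (1 - x k) * slice I (zk N k).
    rewrite sliceB mulrBl mul1r; congr (_ - _).
    rewrite slice_zk /x /ze -scalerAr -mulrA -expID// addNr expI0 mulr1 scalerA.
    by rewrite divff ?scale1r// gt_eqF.
  have xN : x k ^+ N = ze ^+ N.
    rewrite xX mul_rang//.
    have -> : - (k%:R * (2 * pi)) = - (k%:R * (2 * pi)) + 0 :> R by rewrite addr0.
    suff -> : expI I (- (k%:R * (2 * pi)) + 0) = 1 by rewrite mulr1.
    have h : expI I (k%:R * (2 * pi)) = 1 by rewrite -expIM// expI2pi expr1n.
    by rewrite addr0 -[LHS]mulr1 -[X in _ * X]h -expID// addNr expI0.
  have -> : K k * ((1 - x k) * slice I (zk N k)) =
      ((1 - x k) * K k) * slice I (zk N k).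
    rewrite mulrA; congr (_ * _); rewrite mulrBr mulrBl mulr1 mul1r.
    congr (_ - _); rewrite /K mulr_suml mulr_sumr; apply: eq_bigr => n _.
    by rewrite -exprSr -exprS.
  congr (_ * _); rewrite -xN /K; apply/eqP.
  by rewrite -eqr_opp opprB subrX1 -mulNr opprB.
pose G (t : R) := \sum_(k < N) K k * F (z + t *: (zk N k - z)).
have dG (t : R) : is_derive t (1 : R) G ((1 - ze ^+ N) *
    \sum_(k < N) slice I (zk N k) * D (z + t *: (zk N k - z))).
  have -> : G = \sum_(k < N) (fun t => K k * F (z + t *: (zk N k - z))).
    by apply/funext => u; rewrite fct_sumE.
  rewrite mulr_sumr.
  rewrite (eq_bigr (fun k : 'I_N => K k * (slice I (zk N k - z) *
    D (z + t *: (zk N k - z))))) => [|k _]; last by rewrite !mulrA Kz.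
  apply: is_derive_sum => k.
  exact: (is_derive_linear (@quat_mull_linear R (K k)) (quat_mull_bounded (K k))).
(* Since |z| <= r; this is the origin of the factor 2 in the bound. *)
have ze1 : `|1 - ze ^+ N| <= 2.
  rewrite (le_trans (ler_normB _ _))// quat_norm1 quat_normX lerD2l exprn_ile1//.
  by rewrite /ze normrZ gtr0_norm ?invr_gt0// mulrC ler_pdivrMr// mul1r.
have := @mean_value_inequality _ G _ (2 * (N%:R * (r * e))) dG.
have -> : G 0 = N%:R *: F z.
  rewrite /G; under eq_bigr do rewrite scale0r addr0.
  rewrite -mulr_suml /K.
  under eq_bigr do under eq_bigr do rewrite xX.
  rewrite exchange_big/=.
  have h n : (n < N)%N -> \sum_(k < N) expI I (- (k%:R * (n%:R * rang R N))) =
      (if 0%N == n then N else 0)%:R.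
    move=> nN; rewrite -(sum_roots hI N0 nN); apply: eq_bigr => k _.
    by congr expI; ring.
  under eq_bigr => n _ do rewrite -mulr_sumr h//.
  rewrite (bigD1 (Ordinal N0))//= expr0 mul1r big1 ?addr0.
    by rewrite -scaler_nat -scalerAl mul1r.
  move=> n n0; rewrite ifN ?mulr0//; apply: contra n0 => /eqP h0.
  by apply/eqP/val_inj.
have -> : G 1 = N%:R *: \sum_(n < N) slice I z ^+ n * interp_coef N n.
  rewrite /G; under eq_bigr do rewrite scale1r addrC subrK mulr_suml.
  rewrite exchange_big/= scaler_sumr; apply: eq_bigr => n _.
  rewrite /interp_coef /avg scalerAr !scalerA mulrCA divff ?gt_eqF// mulr1.
  rewrite -scalerAr mulr_sumr scaler_sumr; apply: eq_bigr => k _.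
  by rewrite xX /ze exprZn exprVn -!scalerAl -[_ * _ * F _]mulrA.
rewrite -scalerBr normrZ gtr0_norm// distrC => H.
rewrite -(ler_pM2l NR0) (le_trans (H _))//; last by rewrite mulrCA.
move=> t t01; rewrite quat_normM ler_pM//.
exact: telescoping_estimate.
Qed.

Lemma expI_rang_near1 (d : R) : 0 < d ->
  exists2 N, (1 < N)%N & `|expI I (rang R N) - 1| < d.
Proof.
move=> d0; set C := 1 + `|I|.
have C0 : 0 < C by rewrite ltr_pwDl.
have dC : 0 < d / C by exact: divr_gt0.
have /nbhs_normP[h /= h0 Hh] : \forall t \near (0 : R),
    `|cos t - 1| < d / C /\ `|sin t| < d / C.
  near=> t; split; near: t.
    have /cvgrPdist_lt/(_ _ dC) := @continuous_cos R 0.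
    by rewrite cos0; apply: filterS => t; rewrite distrC.
  have /cvgrPdist_lt/(_ _ dC) := @continuous_sin R 0.
  by rewrite sin0; apply: filterS => t; rewrite sub0r normrN.
(* The bound alone gives [rang R N] < h; adding 2 ensures N > 1. *)
pose N := (Num.bound (2 * pi / h)).+2.
exists N => //.
have p0 : 0 < 2 * pi :> R by rewrite mulr_gt0 ?pi_gt0.
have [] := Hh (rang R N).
  rewrite /= sub0r normrN /rang -lock ger0_norm ?divr_ge0 ?(ltW p0)//.
  rewrite ltr_pdivrMr ?ltr0n// -ltr_pdivrMl// [h^-1 * _]mulrC.
  rewrite (lt_le_trans (archi_boundP _)) ?divr_ge0 ?(ltW p0) ?(ltW h0)//.
  by rewrite ler_nat /N leqW.
move=> hc hs.
have -> : expI I (rang R N) - 1 = slice I (cos (rang R N) - 1, sin (rang R N)).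
  by rewrite /expI /slice /= scalerBl scale1r addrAC.
rewrite (le_lt_trans (slice_bounded _ _))// -/C mulrC -ltr_pdivlMr//.
by rewrite prod_normE gt_max hc.
Unshelve. all: by end_near. Qed.

Lemma polynomial_approximation (e : R) : 0 < e ->
  exists N (b : nat -> quat R), forall z, `|slice I z| <= r ->
    `|F z - \sum_(n < N) slice I z ^+ n * b n| <= e.
Proof.
move=> e0; have e2r : 0 < e / (2 * r) by rewrite divr_gt0// mulr_gt0.
have [d d0 Hd] := uniform_continuity_box r cD e2r.
have [N N1 HN] := expI_rang_near1 (divr_gt0 d0 r0).
exists N, (interp_coef N) => z zr.
have -> : e = 2 * (r * (e / (2 * r))).
  by rewrite mulrA [RHS]mulrC divfK// gt_eqF// mulr_gt0.
apply: interpolation_error => // p q pr qp; apply: Hd => //.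
by rewrite (le_lt_trans qp)// mulrC -ltr_pdivlMr.
Qed.

End discrete_cauchy.

(** * From polynomial approximation to a power series *)

Lemma limit_of_rate (R : realType) (u : nat -> R) :
  (forall i j, `|u i - u j| <= i.+1%:R^-1 + j.+1%:R^-1) ->
  exists l, forall i, `|u i - l| <= i.+1%:R^-1.
Proof.
move=> Hu; pose A : set R := range (fun i => u i - i.+1%:R^-1).
have ubA j : ubound A (u j + j.+1%:R^-1).
  move=> _ [i _ <-]; rewrite lerBlDr -addrA -lerBlDl.
  by rewrite (le_trans (ler_norm _))// addrC.
exists (sup A) => i; rewrite ler_distlC; apply/andP; split.
  by apply: ub_le_sup; [exists (u 0 + 1%:R^-1); exact: ubA|exists i].
by apply: ge_sup; [exists (u 0 - 1%:R^-1), 0%N|exact: ubA].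
Qed.

Lemma norm_le_components (R : realType) (x : quat R) :
  `|x| <= `|q_re x| + `|q_i x| + `|q_j x| + `|q_k x|.
Proof.
rewrite -(@ler_pXn2r _ 2)// ?nnegrE ?addr_ge0// sqr_quat_norm.
have h (a : R) : a ^+ 2 = `|a| ^+ 2 by rewrite real_normK ?num_real.
rewrite (h (q_re x)) (h (q_i x)) (h (q_j x)) (h (q_k x)).
move: `|q_re x| `|q_i x| `|q_j x| `|q_k x| (normr_ge0 (q_re x))
  (normr_ge0 (q_i x)) (normr_ge0 (q_j x)) (normr_ge0 (q_k x)) => a b c d a0 b0 c0 d0.
rewrite -subr_ge0.
have -> : (a + b + c + d) ^+ 2 - (a ^+ 2 + b ^+ 2 + c ^+ 2 + d ^+ 2) =
  2 * (a * b + a * c + a * d + b * c + b * d + c * d) by ring.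
by rewrite mulr_ge0// !addr_ge0// mulr_ge0.
Qed.

Lemma norm_components_le (R : realType) (x : quat R) :
  [/\ `|q_re x| <= `|x|, `|q_i x| <= `|x|, `|q_j x| <= `|x| & `|q_k x| <= `|x|].
Proof.
have := sqr_ge0 (q_re x); have := sqr_ge0 (q_i x).
have := sqr_ge0 (q_j x); have := sqr_ge0 (q_k x) => h1 h2 h3 h4.
by split; rewrite -(@ler_pXn2r _ 2)// ?nnegrE// sqr_quat_norm
  real_normK ?num_real//; lra.
Qed.

Lemma quat_limit_of_rate (R : realType) (u : nat -> quat R) :
  (forall i j, `|u i - u j| <= i.+1%:R^-1 + j.+1%:R^-1) ->
  exists l, forall i, `|u i - l| <= 4 * i.+1%:R^-1.
Proof.
move=> Hu.
have Hc i j := norm_components_le (u i - u j).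
have [i|a Ha] := @limit_of_rate R (fun i => q_re (u i)) _.
  by move=> j; have [h _ _ _] := Hc i j; exact: le_trans (Hu i j).
have [i|b Hb] := @limit_of_rate R (fun i => q_i (u i)) _.
  by move=> j; have [_ h _ _] := Hc i j; exact: le_trans (Hu i j).
have [i|c Hc'] := @limit_of_rate R (fun i => q_j (u i)) _.
  by move=> j; have [_ _ h _] := Hc i j; exact: le_trans (Hu i j).
have [i|d Hd] := @limit_of_rate R (fun i => q_k (u i)) _.
  by move=> j; have [_ _ _ h] := Hc i j; exact: le_trans (Hu i j).
exists (Quat a b c d) => i; apply: (le_trans (norm_le_components _)) => /=.
have -> : 4 * i.+1%:R^-1 = i.+1%:R^-1 + i.+1%:R^-1 + i.+1%:R^-1 + i.+1%:R^-1 :> R.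
  by ring.
by do 3 (apply: lerD => //).
Qed.

(** Let P_j approximate F within 1/(j+1) on the disc of radius j+1. Cauchy's estimates make the
    coefficients of P_j converge as j grows; at radius i+1 they bound the n-th coefficient error of
    P_i by a multiple of (i+1)^(-n-1), which is summable on the disc of half that radius. *)
Lemma uniform_power_series (R : realType) (I : quat R) (F : R * R -> quat R) :
  imag_sphere I ->
  (forall r e : R, 0 < r -> 0 < e -> exists N (b : nat -> quat R), forall z,
    `|slice I z| <= r -> `|F z - \sum_(n < N) slice I z ^+ n * b n| <= e) ->
  exists a : nat -> quat R, forall rho e : R, 0 < e ->
    exists M0, forall M, (M0 <= M)%N -> forall z, `|slice I z| <= rho ->
      `|F z - \sum_(n < M) slice I z ^+ n * a n| <= e.
Proof.
move=> hI Happ.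
have [Nb HNb] : exists Nb : nat -> nat * (nat -> quat R), forall (j : nat) z,
    `|slice I z| <= j.+1%:R ->
    `|F z - \sum_(n < (Nb j).1) slice I z ^+ n * (Nb j).2 n| <= j.+1%:R^-1.
  have : forall j, exists Nb : nat * (nat -> quat R), forall z,
      `|slice I z| <= j.+1%:R ->
      `|F z - \sum_(n < Nb.1) slice I z ^+ n * Nb.2 n| <= j.+1%:R^-1.
    move=> j; have [||N [b H]] := Happ j.+1%:R (j.+1%:R^-1).
    - by rewrite ltr0n.
    - by rewrite invr_gt0 ltr0n.
    - by exists (N, b).
  by move=> /choice[f Hf]; exists f.
pose P j z := \sum_(n < (Nb j).1) slice I z ^+ n * (Nb j).2 n.
pose b j n : quat R := if (n < (Nb j).1)%N then (Nb j).2 n else 0.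
(* Cauchy's estimate: [avg] extracts the coefficient of P_i - P_j exactly and does not exceed its
   bound on the circle of radius rho. *)
have bdiff i j n (rho : R) : 0 <= rho -> rho <= i.+1%:R -> rho <= j.+1%:R ->
    rho ^+ n * `|b i n - b j n| <= i.+1%:R^-1 + j.+1%:R^-1.
  move=> rho0 ri rj; pose N := (maxn n.+1 (maxn (Nb i).1 (Nb j).1)).
  have nN : (n < N)%N by rewrite /N leq_maxl.
  have iN : ((Nb i).1 <= N)%N by rewrite /N !leq_max leqnn !orbT.
  have jN : ((Nb j).1 <= N)%N by rewrite /N !leq_max leqnn !orbT.
  have sr : slice I (rho, 0) = rho%:A by rewrite /slice /= scale0r addr0.
  have nsr : `|slice I (rho, 0)| = rho.
    by rewrite sr normrZ quat_norm1 mulr1 ger0_norm.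
  have -> : rho ^+ n * `|b i n - b j n| =
      `|avg I N n (fun z => P i z - P j z) (rho, 0)|.
    rewrite avgB !avg_poly//.
    have h k : (if (n < (Nb k).1)%N then slice I (rho, 0) ^+ n * (Nb k).2 n else 0)
        = slice I (rho, 0) ^+ n * b k n.
      by rewrite /b; case: ifP; rewrite ?mulr0.
    by rewrite !h -mulrBr quat_normM quat_normX nsr.
  apply: norm_avg_le => //; first exact: leq_ltn_trans nN.
  move=> q; rewrite nsr => qr.
  have -> : P i q - P j q = (F q - P j q) - (F q - P i q).
    by rewrite opprB [RHS]addrC subrKA.
  rewrite (le_trans (ler_normB _ _))// addrC lerD//.
    by apply: HNb; rewrite qr.
  by apply: HNb; rewrite qr.
have [a Ha] : exists a : nat -> quat R, forall n i,
    `|b i n - a n| <= 4 * i.+1%:R^-1.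
  have : forall n, exists l, forall i, `|b i n - l| <= 4 * i.+1%:R^-1.
    move=> n; apply: (@quat_limit_of_rate R (b^~ n)) => i j.
    have := @bdiff i j n 1 ler01; rewrite expr1n mul1r; apply.
      by rewrite ler1n.
    by rewrite ler1n.
  by move=> /choice[f Hf]; exists f.
(* Letting j grow in [bdiff] at radius i+1; the index j below is large enough to absorb the factor
   (i+1)^n. *)
have Ha' n i : i.+1%:R ^+ n * `|b i n - a n| <= 2 * i.+1%:R^-1.
  apply/ler_addgt0Pr => e e0; set rho : R := i.+1%:R.
  have rho0 : 0 < rho by rewrite ltr0n.
  pose C := 1 + 4 * rho ^+ n.
  have C0 : 0 < C by rewrite /C ltr_pwDl// mulr_ge0// exprn_ge0// ltW.
  pose j := (i + Num.bound (C / e))%N.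
  have j1 : j.+1%:R^-1 * C <= e.
    rewrite mulrC ler_pdivrMr ?ltr0n// mulrC -ler_pdivrMr//.
    rewrite (le_trans (ltW (archi_boundP _)))//; first by rewrite divr_ge0 ?ltW.
    by rewrite ler_nat /j leqW// leq_addl.
  have ij : rho <= j.+1%:R by rewrite ler_nat ltnS leq_addr.
  have h1 := @bdiff i j n rho (ltW rho0) (lexx _) ij.
  have h2 := ler_wpM2l (exprn_ge0 n (ltW rho0)) (Ha n j).
  rewrite -(subrKA (b j n)).
  apply: le_trans (ler_wpM2l (exprn_ge0 n (ltW rho0)) (ler_normD _ _)) _.
  rewrite mulrDr.
  have h3 : 0 <= rho^-1 by rewrite invr_ge0 ltW.
  move: j1; rewrite /C mulrDr mulr1 => j1.
  have -> : 2 * rho^-1 + e = rho^-1 + (rho^-1 + e) by ring.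
  move: h1 h2; rewrite -/rho => h1 h2.
  have h4 : rho ^+ n * (4 * j.+1%:R^-1) = j.+1%:R^-1 * (4 * rho ^+ n) by ring.
  apply: le_trans (lerD h1 h2) _; rewrite h4 -addrA lerD2l.
  by apply: le_trans j1 _; rewrite lerDr.
exists a => rho e e0.
(* 2 rho <= i+1 makes the ratio of the geometric series 1/2. The 5 is 1 for the error of P_i plus 2
   * 2 for the sum of the coefficient errors. *)
pose i := maxn (Num.bound (2 * rho)) (Num.bound (5 / e)).
have i1 : 2 * rho <= i.+1%:R.
  by rewrite (le_trans (ltW (unstable.ltr_bound _)))// ler_nat leqW// leq_maxl.
have i5 : 5 * i.+1%:R^-1 <= e.
  rewrite ler_pdivrMr ?ltr0n// mulrC -ler_pdivrMr//.
  by rewrite (le_trans (ltW (unstable.ltr_bound _)))// ler_nat leqW// leq_maxr.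
have geo M : \sum_(n < M) (2^-1 : R) ^+ n = 2 - 2 * 2^-1 ^+ M.
  elim: M => [|M IH]; first by rewrite big_ord0 expr0; ring.
  by rewrite big_ord_recr /= IH exprS; field.
exists (Nb i).1 => M NM z zr; set s := slice I z.
have -> : F z - \sum_(n < M) s ^+ n * a n =
    (F z - P i z) + \sum_(n < M) s ^+ n * (b i n - a n).
  under [in RHS]eq_bigr do rewrite mulrBr.
  rewrite sumrB addrA; congr (_ - _); rewrite -[LHS]addr0 -addrA; congr (_ + _).
  apply/esym/eqP; rewrite addrC subr_eq0 /P (big_ord_widen M (fun n =>
    slice I z ^+ n * (Nb i).2 n) NM) [eqbRHS]big_mkcond/=; apply/eqP.
  apply: eq_bigr => n _.
  by rewrite /b; case: ifP; rewrite ?mulr0.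
have s2 : 2 * `|s| <= i.+1%:R by apply: le_trans i1; rewrite ler_pM2l.
apply: le_trans (ler_normD _ _) _.
have h1 : `|F z - P i z| <= i.+1%:R^-1.
  apply: HNb; apply: le_trans s2; rewrite mulr_natl mulr2n lerDl//.
have h2 : `|\sum_(n < M) s ^+ n * (b i n - a n)| <= 2 * (2 * i.+1%:R^-1).
  apply: le_trans (ler_norm_sum _ _ _) _.
  apply: le_trans (_ : \sum_(n < M) 2^-1 ^+ n * (2 * i.+1%:R^-1) <= _).
    apply: ler_sum => n _; rewrite quat_normM quat_normX.
    have h : `|s| <= 2^-1 * i.+1%:R by lra.
    apply: le_trans (ler_wpM2r (normr_ge0 _) (lerXn2r n _ _ h)) _.
    - by rewrite nnegrE.
    - by rewrite nnegrE mulr_ge0.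
    rewrite exprMn -mulrA ler_wpM2l// ?exprn_ge0//.
  rewrite -mulr_suml geo ler_wpM2r//.
  by rewrite lerBlDr lerDl mulr_ge0// exprn_ge0.
apply: le_trans (lerD h1 h2) _; apply: le_trans i5.
by rewrite le_eqVlt; apply/orP; left; apply/eqP; ring.
Qed.

Section slice_regular_series.
Variables (R : realType) (I : quat R).
Hypothesis hI : imag_sphere I.
Variable f : quat R -> quat R.
Hypothesis rf : slice_regular f.
Let F := restrict_slice I f.
Let D := fun p => 'D_(1, 0) F p.

Lemma slice_regular_differentiable p : differentiable F p.
Proof.
have [df _] := rf.
apply: differentiable_comp; last exact: df.
pose LM := GRing.isLinear.Build _ _ _ _ _ (@slice_linear R I).
pose L : {linear (R * R)%type -> quat R} := HB.pack (slice I) LM.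
apply: (@linear_differentiable _ _ _ L).
exact: lipschitz_linear_continuous (@slice_linear R I) (@slice_bounded R I).
Qed.

(** Multiplying the Cauchy-Riemann equation by I gives the y-derivative as I times the x-derivative;
    real differentiability makes the derivative linear in v. *)
Lemma slice_regular_derive p v : 'D_v F p = slice I v * D p.
Proof.
have [_ /(_ I hI)[_ _ _ CR]] := rf.
have dFp := slice_regular_differentiable p.
have E : 'D_(0, 1) F p = I * D p.
  have /eqP := CR p; rewrite scaler_eq0 invr_eq0 pnatr_eq0/= => /eqP h.
  have : I * ('D_(1, 0) F p + I * 'D_(0, 1) F p) = 0 by rewrite h mulr0.
  rewrite mulrDr mulrA sqr_imag_sphere// mulN1r => /eqP.
  by rewrite subr_eq0 => /eqP <-.
have Ev : v = v.1 *: (1, 0) + v.2 *: (0, 1).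
  case: v => x y; congr (_, _) => /=.
    by rewrite /GRing.scale/= mulr1 mulr0 addr0.
  by rewrite /GRing.scale/= mulr1 mulr0 add0r.
rewrite deriveE// {1}Ev linearD !linearZ/= -!deriveE// E /slice /=.
by rewrite mulrDl -!scalerAl mul1r.
Qed.

Lemma slice_regular_line p v (t : R) :
  is_derive t (1 : R) (fun s => F (p + s *: v)) (slice I v * D (p + t *: v)).
Proof.
have dF : derivable F (p + t *: v) v.
  by apply: diff_derivable; exact: slice_regular_differentiable.
have E : (fun h : R => h^-1 *: (((fun s => F (p + s *: v)) \o shift t) (h *: 1) -
    F (p + t *: v))) =
   (fun h : R => h^-1 *: ((F \o shift (p + t *: v)) (h *: v) - F (p + t *: v))).
  apply/funext => h /=; congr (_ *: (F _ - _)).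
  by rewrite scaler1 scalerDl addrCA.
rewrite -slice_regular_derive; apply: DeriveDef.
  by rewrite /derivable E.
by rewrite /derive E.
Qed.

Lemma slice_regular_power_series :
  exists a : nat -> quat R, forall rho e : R, 0 < e ->
    exists M0, forall M, (M0 <= M)%N -> forall z, `|slice I z| <= rho ->
      `|f (slice I z) - \sum_(n < M) slice I z ^+ n * a n| <= e.
Proof.
apply: (@uniform_power_series R I F hI) => r e r0 e0.
apply: (polynomial_approximation hI slice_regular_line _ r0 e0).
by have [_ /(_ I hI)[_ h _ _]] := rf.
Qed.

End slice_regular_series.

(** * Rotation invariance of the Lebesgue integral on the plane *)

Section change_of_variables.
Variable R : realType.
Local Notation mu := (@lebesgue_measure R).
Local Open Scope ereal_scope.

(** The pushforward of the Lebesgue measure under x -> c x + d, scaled by |c|, gives every half-open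
    interval its length, hence is the Lebesgue measure. *)
Lemma ge0_integral_affine (c d : R) (f : R -> \bar R) : c != 0%R ->
  measurable_fun setT f -> (forall x, 0 <= f x) ->
  \int[mu]_x f (c * x + d)%R = (`|c|^-1)%:E * \int[mu]_x f x.
Proof.
move=> c0 mf f0; pose phi (x : R) : R := (c * x + d)%R.
have mphi : measurable_fun setT phi.
  by apply: measurable_funD => //; exact: measurable_funM.
have kge0 : (0 <= `|c|)%R by exact: normr_ge0.
have mphi' : @measurable_fun _ _ (measurableTypeR R) (measurableTypeR R) setT phi.
  exact: mphi.
pose m : {measure set (measurableTypeR R) -> \bar R} :=
  mscale (NngNum kge0) (measure_function_pushforward__canonical__measure_function_Measure
    mu mphi').
have mE : forall A, measurable A -> mu A = m A.
  apply: lebesgue_measure_unique => _ [[a b] _ <-] /=.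
  rewrite /m /mscale /= /pushforward.
  have [c_gt0|c_lt0|c0'] := ltgtP 0%R c; last by rewrite -c0' eqxx in c0.
    have -> : phi @^-1` `]a, b] = [set` `](a - d) / c, (b - d) / c]%R].
      apply/seteqP; split => x /=; rewrite !in_itv/= ltr_pdivrMr// ler_pdivlMr//
        ltrBlDr lerBrDr mulrC; done.
    rewrite !lebesgue_measure_itv/= !lte_fin ltr_pM2r ?invr_gt0// ltrD2r.
    case: ifPn => _; last by rewrite mule0.
    rewrite -!EFinD -EFinM; congr EFin; rewrite gtr0_norm//.
    by field; rewrite gt_eqF.
  have -> : phi @^-1` `]a, b] = [set` `[(b - d) / c, (a - d) / c[%R].
    apply/seteqP; split => x /=; rewrite !in_itv/= ltr_ndivlMr// ler_ndivrMr//
      ltrBlDr lerBrDr mulrC andbC; done.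
  rewrite !lebesgue_measure_itv/= !lte_fin ltr_nM2r ?invr_lt0// ltrD2r.
  case: ifPn => _; last by rewrite mule0.
  rewrite -!EFinD -EFinM; congr EFin; rewrite ltr0_norm//.
  by field; rewrite lt_eqF.
have -> : \int[mu]_x f x = \int[m]_x f x.
  by apply: eq_measure_integral => A mA _; exact: mE.
rewrite ge0_integral_mscale// muleA -EFinM /= mulVf ?normr_eq0// mul1e.
by rewrite ge0_integral_pushforward.
Qed.

Lemma ge0_integral_plane1 (h : R * R -> \bar R) :
  measurable_fun setT h -> (forall p, 0 <= h p) ->
  \int[mu \x mu]_p h p = \int[mu]_x \int[mu]_y h (x, y).
Proof.
exact: (@fubini_tonelli1 _ _ (measurableTypeR R) (measurableTypeR R) R mu mu h).
Qed.

Lemma ge0_integral_plane2 (h : R * R -> \bar R) :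
  measurable_fun setT h -> (forall p, 0 <= h p) ->
  \int[mu \x mu]_p h p = \int[mu]_y \int[mu]_x h (x, y).
Proof.
exact: (@fubini_tonelli2 _ _ (measurableTypeR R) (measurableTypeR R) R mu mu h).
Qed.

(** By Tonelli, the first coordinate is integrated first, along which the shear is a translation. *)
Lemma ge0_integral_shear1 (a : R) (f : R * R -> \bar R) :
  measurable_fun setT f -> (forall x, 0 <= f x) ->
  \int[mu \x mu]_p f (p.1 + a * p.2, p.2)%R = \int[mu \x mu]_p f p.
Proof.
move=> mf f0.
have mg : measurable_fun setT (fun p : R * R => (p.1 + a * p.2, p.2)%R).
  apply: measurable_fun_pair => //.
  by apply: measurable_funD => //; exact: measurable_funM.
rewrite (@ge0_integral_plane2 (fun p => f (p.1 + a * p.2, p.2)%R))//; last first.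
  exact: measurableT_comp mf mg.
rewrite (ge0_integral_plane2 mf f0); apply: eq_integral => y _.
transitivity (\int[mu]_x f (1 * x + a * y, y)%R).
  by apply: eq_integral => x _; rewrite mul1r.
rewrite (@ge0_integral_affine 1 (a * y) (fun x => f (x, y)))//; last exact: measurable_fun_pair1.
by rewrite normr1 invr1 mul1e.
Qed.

Lemma ge0_integral_shear2 (a : R) (f : R * R -> \bar R) :
  measurable_fun setT f -> (forall x, 0 <= f x) ->
  \int[mu \x mu]_p f (p.1, p.2 + a * p.1)%R = \int[mu \x mu]_p f p.
Proof.
move=> mf f0.
have mg : measurable_fun setT (fun p : R * R => (p.1, p.2 + a * p.1)%R).
  apply: measurable_fun_pair => //.
  by apply: measurable_funD => //; exact: measurable_funM.
rewrite (@ge0_integral_plane1 (fun p => f (p.1, p.2 + a * p.1)%R))//; last first.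
  exact: measurableT_comp mf mg.
rewrite (ge0_integral_plane1 mf f0); apply: eq_integral => x _.
transitivity (\int[mu]_y f (x, 1 * y + a * x)%R).
  by apply: eq_integral => y _; rewrite mul1r.
rewrite (@ge0_integral_affine 1 (a * x) (fun y => f (x, y)))//; last exact: measurable_fun_pair2.
by rewrite normr1 invr1 mul1e.
Qed.

Lemma measurable_rotp t : measurable_fun setT (@rotp R t).
Proof.
apply: measurable_fun_pair => /=.
  by apply: measurable_funB; exact: measurable_funM.
by apply: measurable_funD; exact: measurable_funM.
Qed.

(* When sin t is nonzero the rotation is a product of three shears; otherwise it
   is a product of two rotations of that kind. *)
Lemma ge0_integral_rotp (t : R) (f : R * R -> \bar R) :
  measurable_fun setT f -> (forall x, 0 <= f x) ->
  \int[mu \x mu]_p f (rotp t p) = \int[mu \x mu]_p f p.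
Proof.
have rot_sin s g : sin s != 0%R -> measurable_fun setT g -> (forall x, 0 <= g x) ->
    \int[mu \x mu]_p g (rotp s p) = \int[mu \x mu]_p g p.
  (* a = - tan (s / 2), the slope of the outer shears in rotation = S1 S2 S1. *)
  move=> s0 mg g0; pose a := ((cos s - 1) / sin s)%R.
  pose S1 (p : R * R) := (p.1 + a * p.2, p.2)%R.
  pose S2 (p : R * R) := (p.1, p.2 + sin s * p.1)%R.
  have mS1 : measurable_fun setT S1.
    apply: measurable_fun_pair => //.
    by apply: measurable_funD => //; exact: measurable_funM.
  have mS2 : measurable_fun setT S2.
    apply: measurable_fun_pair => //.
    by apply: measurable_funD => //; exact: measurable_funM.
  transitivity (\int[mu \x mu]_p g (S1 (S2 (S1 p)))).
    apply: eq_integral => -[x y] _; congr g.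
    rewrite /rotp /cmul /S1 /S2 /=.
    have as1 : (a * sin s = cos s - 1)%R by rewrite /a divfK.
    have cs : (cos s ^+ 2 + sin s ^+ 2 = 1)%R by exact: cos2Dsin2.
    have aa : (a * (1 + cos s) = - sin s)%R.
      apply: (mulIf s0); rewrite mulrAC as1 mulNr -expr2.
      by move: cs; rewrite !expr2 => cs; lra.
    congr (_, _).
      transitivity (x * (1 + a * sin s) + y * (a * (1 + (1 + a * sin s))))%R;
        last by ring.
      by rewrite as1 addrCA subrr addr0 aa; ring.
    transitivity (sin s * x + y * (1 + a * sin s))%R; last by ring.
    by rewrite as1 addrCA subrr addr0; ring.
  have m1 : measurable_fun setT (g \o S1) := measurableT_comp mg mS1.
  rewrite (ge0_integral_shear1 a (measurableT_comp m1 mS2))//; last first.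
    by move=> x; exact: g0.
  rewrite (ge0_integral_shear2 (sin s) m1)//; last by move=> x; exact: g0.
  exact: ge0_integral_shear1.
move=> mf f0.
have [s0|] := eqVneq (sin t) 0%R; last by move=> s0; exact: rot_sin.
(* Both angles have nonzero sine: sin (t - pi / 2) = - cos t, and cos t is nonzero when sin t =
   0. *)
transitivity (\int[mu \x mu]_p f (rotp (t - pi / 2) (rotp (pi / 2) p))).
  apply: eq_integral => -[x y] _; congr f.
  rewrite /rotp /cmul /= cosB sinB cos_pihalf sin_pihalf.
  by congr (_, _); ring.
rewrite (rot_sin (pi / 2)%R (f \o rotp (t - pi / 2)%R))//.
- rewrite rot_sin//.
  rewrite sinB cos_pihalf sin_pihalf s0 mul0r mulr1 sub0r oppr_eq0.
  apply/eqP => c0; have := cos2Dsin2 t; rewrite c0 s0 expr0n/= addr0 => /eqP.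
  by rewrite eq_sym oner_eq0.
- by rewrite sin_pihalf oner_neq0.
- by apply: measurableT_comp => //; exact: measurable_rotp.
- by move=> x; exact: f0.
Qed.

Lemma ge0_integral_even (f : R -> \bar R) : measurable_fun setT f ->
  (forall x, 0 <= f x) -> (forall x, f (- x)%R = f x) ->
  \int[mu]_x f x = 2%:E * \int[mu]_(x in `]0%R, +oo[) f x.
Proof.
move=> mf f0 fN.
have <- : \int[mu]_(x in `[0%R, +oo[) f x = \int[mu]_(x in `]0%R, +oo[) f x.
  by rewrite integral_itv_obnd_cbnd//; exact: measurable_funTS.
have -> : [set: R] = [set` `]-oo, 0%R[] `|` [set` `[0%R, +oo[].
  apply/seteqP; split => x //= _; rewrite !in_itv/= andbT.
  by case: (ltP x 0%R); [left|right].
rewrite ge0_integral_setU//=; last 2 first.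
  exact: measurable_funTS.
  apply/disj_setPLR => x /=; rewrite !in_itv/= andbT => x0; apply/negP.
  by rewrite -ltNge.
have <- : \int[mu]_(x in `]0%R, +oo[) f x = \int[mu]_(x in `]-oo, 0%R[) f x.
  rewrite integral_mkcond [RHS]integral_mkcond.
  rewrite -[LHS]mul1e -invr1 -(normrN1 R).
  rewrite -(ge0_integral_affine 0 (c := -1)).
  - apply: eq_integral => x _; rewrite mulN1r addr0 /patch !mem_setE !in_itv/=.
    by rewrite andbT oppr_gt0 fN.
  - by rewrite oppr_eq0 oner_eq0.
  - by apply/(measurable_restrictT _ _).1 => //; exact: measurable_funTS.
  - by move=> x; rewrite /patch; case: ifP.
rewrite integral_itv_obnd_cbnd; last exact: measurable_funTS.
by rewrite mule_natl mule2n.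
Qed.

(** The substitution rule on [-n, n], followed by monotone convergence on both sides. *)
Lemma ge0_integral_expR (G : R -> R) :
  (forall x, 0 < x -> 0 <= G x)%R -> (forall x, 0 < x -> {for x, continuous G})%R ->
  measurable_fun setT G ->
  \int[mu]_(x in `]0%R, +oo[) (G x)%:E = \int[mu]_t (G (expR t) * expR t)%:E.
Proof.
move=> G0 cG mG.
have m1 : measurable_fun setT (fun t : R => (G (expR t) * expR t)%:E).
  apply/measurable_EFinP/measurable_funM; last exact: measurable_expR.
  by apply: measurableT_comp => //; exact: measurable_expR.
pose A n := [set` `[expR (- n%:R) : R, expR n%:R]].
pose B n := [set` `[(- n%:R)%R : R, (n%:R)%R]].
have AE : \bigcup_i A i = [set` `]0%R, +oo[].
  apply/seteqP; split => x /=.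
    move=> [n _]; rewrite /A /= !in_itv/= andbT => /andP[h _].
    by apply: lt_le_trans h; exact: expR_gt0.
  rewrite in_itv/= andbT => x0; exists (Num.bound (ln x)) => //.
  rewrite /A /= in_itv/= -{2 3}(lnK (x := x)) ?posrE// !ler_expR -ler_norml.
  exact/ltW/unstable.ltr_norm_bound.
have BE : \bigcup_i B i = setT.
  apply/seteqP; split => x //= _; exists (Num.bound x) => //.
  by rewrite /B /= in_itv/= -ler_norml; exact/ltW/unstable.ltr_norm_bound.
have cA : \int[mu]_(x in A n) (G x)%:E @[n --> \oo] -->
    \int[mu]_(x in `]0%R, +oo[) (G x)%:E.
  rewrite -AE; apply: ge0_nondecreasing_set_cvg_integral => //.
  - move=> n m nm; apply/subsetPset => x; rewrite /A /= !in_itv/= => /andP[h1 h2].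
    by rewrite (le_trans _ h1) ?(le_trans h2)// ler_expR ?lerN2 ler_nat.
  - by move=> n; exact: measurable_itv.
  - by move=> n; apply: measurable_funTS; apply/measurable_EFinP.
  - move=> n x; rewrite /A /= in_itv/= lee_fin => /andP[h _]; apply: G0.
    by apply: lt_le_trans h; exact: expR_gt0.
have cB : \int[mu]_(x in B n) (G (expR x) * expR x)%:E @[n --> \oo] -->
    \int[mu]_x (G (expR x) * expR x)%:E.
  rewrite -BE; apply: ge0_nondecreasing_set_cvg_integral => //.
  - move=> n m nm; apply/subsetPset => x; rewrite /B /= !in_itv/= => /andP[h1 h2].
    by rewrite (le_trans _ h1) ?(le_trans h2)// ?lerN2 ler_nat.
  - by move=> n; exact: measurable_itv.
  - by move=> n; apply: measurable_funTS.
  - by move=> n x _; rewrite lee_fin mulr_ge0 ?expR_ge0// G0 ?expR_gt0.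
rewrite -(cvg_lim _ cA)// -(cvg_lim _ cB)//; congr (limn _); apply/funext => n.
have dE : expR^`()%classic = @expR R.
  by apply/funext => x; rewrite derive1E; exact: derive_val.
rewrite /A /B integration_by_substitution_increasing ?dE.
- by [].
- by rewrite (@le_trans _ _ 0%R)// oppr_le0.
- by move=> x y _ _; rewrite ltr_expR.
- by move=> x _; exact: continuous_expR.
- by apply/cvg_ex; exists (expR (- n%:R));
    apply: cvg_at_right_filter; exact: continuous_expR.
- by apply/cvg_ex; exists (expR (n%:R));
    apply: cvg_at_left_filter; exact: continuous_expR.
- split => //.
  + by apply: cvg_at_right_filter; exact: continuous_expR.
  + by apply: cvg_at_left_filter; exact: continuous_expR.
- apply: continuous_in_subspaceT => x; rewrite inE/= in_itv/= => /andP[h _].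
  by apply: cG; apply: lt_le_trans h; exact: expR_gt0.
Qed.

End change_of_variables.

(** * Gamma integrals and the moments of the Macdonald density *)

Section log_gamma_integral.
Variable R : realType.
Local Notation mu := (@lebesgue_measure R).
Local Open Scope ereal_scope.

(** Gamma(a) after s = e^t. On the whole line, scalings become translations; extended values let
    Tonelli be used before finiteness is known. *)
Definition lgam (a : R) : \bar R := \int[mu]_t (expR (a * t - expR t))%:E.

Lemma measurable_lgam_integrand (a c : R) :
  measurable_fun setT (fun t : R => (expR (a * t - c * expR t))%:E).
Proof.
apply/measurable_EFinP; apply: measurableT_comp; first exact: measurable_expR.
apply: measurable_funB; first exact: measurable_funM.
by apply: measurable_funM => //; exact: measurable_expR.
Qed.

Lemma lgam_scale (a c : R) : (0 < c)%R ->
  \int[mu]_t (expR (a * t - c * expR t))%:E =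
  (expR (- a * ln c))%:E * lgam a.
Proof.
move=> c0.
have m1 : measurable_fun setT (fun t : R => (expR (a * t - expR t))%:E).
  by under eq_fun do rewrite -[expR _ in X in expR X]mul1r;
    exact: measurable_lgam_integrand.
transitivity (\int[mu]_t ((expR (- a * ln c))%:E *
    (expR (a * (1 * t + ln c) - expR (1 * t + ln c)))%:E)).
  apply: eq_integral => t _; rewrite -EFinM -expRD mul1r [expR (t + _)]expRD lnK ?posrE//.
  by congr (expR _)%:E; ring.
have e0 : (0 <= expR (- a * ln c))%R by exact: expR_ge0.
have mg : measurable_fun setT (fun t : R => 1 * t + ln c)%R.
  by apply: measurable_funD => //; exact: measurable_funM.
rewrite (ge0_integralZl_EFin mu measurableT _ (measurableT_comp m1 mg) e0).
  rewrite (@ge0_integral_affine _ 1 (ln c)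
    (fun t => (expR (a * t - expR t))%:E))//.
    by rewrite normr1 invr1 mul1e.
  by move=> t; rewrite lee_fin expR_ge0.
Qed.

Lemma integral_expRN_itv (a : R) :
  \int[mu]_(x in `[a, +oo[) (expR (- x))%:E = (expR (- a))%:E.
Proof.
have cE : continuous (fun x : R => expR (- x)).
  move=> x; apply: continuous_comp; first exact: opp_continuous.
  exact: continuous_expR.
have dF (x : R) : is_derive x (1%R : R) (fun x => - expR (- x))%R (expR (- x)).
  have h : is_derive x (1%R : R) (expR \o -%R) (expR (- x) * -1)%R.
    apply: is_derive1_comp.
  have := is_deriveN h; rewrite mulrN1 opprK; exact.
rewrite (@ge0_continuous_FTC2y _ _ (fun x => - expR (- x))%R a 0%R).
- by rewrite sub0e -EFinN opprK.
- by move=> x _; exact: expR_ge0.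
- exact: continuous_subspaceT.
- rewrite -oppr0; apply: cvgN; exact: cvgr_expR.
- by move=> x _; have [] := dF x.
- apply: cvg_at_right_filter; apply: cvgN; exact: cE.
- by move=> x _; rewrite derive1E; exact: derive_val.
Qed.

Lemma integral_expR_expR_itv (a : R) :
  \int[mu]_(x in `[a, +oo[) (expR (x - expR x))%:E = (expR (- expR a))%:E.
Proof.
have cE : continuous (fun x : R => expR (x - expR x)).
  move=> x; apply: continuous_comp; last exact: continuous_expR.
  by apply: continuousB => //; exact: continuous_expR.
have cF : continuous (fun x : R => expR (- expR x)).
  move=> x; apply: continuous_comp; last exact: continuous_expR.
  by apply: continuousN; exact: continuous_expR.
have dF (x : R) : is_derive x (1%R : R) (fun x => - expR (- expR x))%R
    (expR (x - expR x)).
  have h : is_derive x (1%R : R) (expR \o (fun x => - expR x))%R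
     (expR (- expR x) * (- expR x))%R.
    by apply: is_derive1_comp.
  have := is_deriveN h; rewrite mulrN opprK -expRD [(- _ + _)%R]addrC; exact.
rewrite (@ge0_continuous_FTC2y _ _ (fun x => - expR (- expR x))%R a 0%R).
- by rewrite sub0e -EFinN opprK.
- by move=> x _; exact: expR_ge0.
- exact: continuous_subspaceT.
- rewrite -oppr0; apply: cvgN.
  apply: (@cvg_comp _ _ _ _ (fun x : R => expR (- x)) _ +oo%R); last exact: cvgr_expR.
  apply/cvgryPge => A; near=> x.
  by rewrite (le_trans _ (expR_ge1Dx _))// (@le_trans _ _ x)// lerDr.
- by move=> x _; have [] := dF x.
- apply: cvg_at_right_filter; apply: cvgN; exact: cF.
- by move=> x _; rewrite derive1E; exact: derive_val.
Unshelve. all: by end_near. Qed.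

Lemma integral_if_ge (a : R) (g : R -> R) :
  \int[mu]_x (if (a <= x)%R then (g x)%:E else 0) =
  \int[mu]_(x in `[a, +oo[) (g x)%:E.
Proof.
rewrite [RHS]integral_mkcond; apply: eq_integral => x _.
by rewrite /patch mem_setE in_itv/= andbT.
Qed.

(** Tonelli replaces integration by parts: a e^(ax) e^(y - e^y) on x <= y integrates in y to a
    e^(ax) e^(-e^x), and in x to e^(ay) e^(y - e^y). *)
Lemma lgam_recursion (a : R) : (0 < a)%R -> a%:E * lgam a = lgam (a + 1).
Proof.
move=> a0.
pose K (p : R * R) : \bar R := if (p.1 <= p.2)%R
  then (a * expR (a * p.1) * expR (p.2 - expR p.2))%:E else 0.
have mK : measurable_fun setT K.
  apply: measurable_fun_ifT => //.
    by apply: measurable_fun_ler.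
  apply/measurable_EFinP; apply: measurable_funM.
    apply: measurable_funM => //; apply: measurableT_comp.
      exact: measurable_expR.
    exact: measurable_funM.
  apply: measurableT_comp; first exact: measurable_expR.
  by apply: measurable_funB => //; apply: measurableT_comp => //; exact: measurable_expR.
have K0 p : 0 <= K p.
  by rewrite /K; case: ifP => // _; rewrite lee_fin !mulr_ge0 ?expR_ge0// ltW.
transitivity (\int[mu]_x \int[mu]_y K (x, y)).
  rewrite /lgam -ge0_integralZl//=.
  - apply: eq_integral => x _.
    transitivity (\int[mu]_y ((a * expR (a * x))%:E *
        (if (x <= y)%R then (expR (y - expR y))%:E else 0))).
      rewrite ge0_integralZl//=.
      + by rewrite integral_if_ge integral_expR_expR_itv -!EFinM expRD mulrA.
      + apply: measurable_fun_ifT => //; first exact: measurable_fun_ler.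
        apply/measurable_EFinP/measurableT_comp; first exact: measurable_expR.
        by apply: measurable_funB => //; exact: measurable_expR.
      + by move=> y _; case: ifP => // _; rewrite lee_fin expR_ge0.
      + by rewrite lee_fin mulr_ge0 ?expR_ge0// ltW.
    by apply: eq_integral => y _; rewrite /K /=; case: ifP; rewrite ?mule0.
  - by under eq_fun do rewrite -[expR _ in X in expR X]mul1r;
      exact: measurable_lgam_integrand.
  - by rewrite lee_fin ltW.
rewrite -(ge0_integral_plane1 mK K0) (ge0_integral_plane2 mK K0).
apply: eq_integral => y _.
(* The substitution v = - a x turns x <= y into v >= - a y. *)
pose h (v : R) : \bar R := if (- (a * y) <= v)%R then (expR (- v))%:E else 0.
have mh : measurable_fun setT h.
  apply: measurable_fun_ifT => //; first exact: measurable_fun_ler.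
  apply/measurable_EFinP/measurableT_comp; first exact: measurable_expR.
  exact: oppr_measurable.
have h0 v : 0 <= h v by rewrite /h; case: ifP => // _; rewrite lee_fin expR_ge0.
have mh' : measurable_fun setT (fun x : R => h (- a * x + 0)%R).
  by apply: (measurableT_comp mh); apply: measurable_funD => //; exact: measurable_funM.
transitivity (\int[mu]_x ((a * expR (y - expR y))%:E * h (- a * x + 0)%R)).
  apply: eq_integral => x _; rewrite /K /h /= addr0 mulNr lerN2 ler_pM2l//.
  by case: ifP; rewrite ?mule0// => _; rewrite -EFinM opprK; congr EFin; ring.
rewrite ge0_integralZl//=; last by rewrite lee_fin mulr_ge0 ?expR_ge0// ltW.
rewrite ge0_integral_affine//; last by rewrite oppr_eq0 gt_eqF.
rewrite /h integral_if_ge integral_expRN_itv opprK normrN gtr0_norm// -!EFinM.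
have -> : expR ((a + 1) * y - expR y) = (expR (y - expR y) * expR (a * y))%R.
  by rewrite -expRD; congr expR; ring.
by congr EFin; field; rewrite gt_eqF.
Qed.

Lemma integral_gamma (z : R) :
  \int[mu]_(t in `]0%R, +oo[) (t `^ (z - 1) * expR (- t))%:E = lgam z.
Proof.
rewrite (ge0_integral_expR (G := fun t => t `^ (z - 1) * expR (- t))%R).
- apply: eq_integral => t _; rewrite /powR gt_eqF ?expR_gt0// expRK -!expRD.
  by congr (expR _)%:E; ring.
- by move=> x _; rewrite mulr_ge0 ?powR_ge0 ?expR_ge0.
- move=> x x0; apply: continuousM.
    apply: differentiable_continuous; apply/derivable1_diffP.
    by have [] := @is_derive1_powR R (z - 1) x x0.
  by apply: continuous_comp; [exact: opp_continuous|exact: continuous_expR].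
- apply: measurable_funM; first exact: measurable_powR.
  apply: measurableT_comp; first exact: measurable_expR.
  exact: oppr_measurable.
Qed.

Lemma lgam1 : lgam 1 = 1.
Proof.
rewrite -integral_gamma integral_itv_obnd_cbnd.
  transitivity (\int[mu]_(t in `[0%R, +oo[) (expR (- t))%:E).
    by apply: eq_integral => t _; rewrite subrr powRr0 mul1r.
  by rewrite integral_expRN_itv oppr0 expR0.
apply: measurable_funTS; apply/measurable_EFinP.
apply: measurable_funM; first exact: measurable_powR.
apply: measurableT_comp; first exact: measurable_expR.
exact: oppr_measurable.
Qed.

Lemma lgam_nat (n : nat) : lgam n.+1%:R = (n`!%:R)%:E.
Proof.
elim: n => [|n IH]; first by rewrite lgam1.
by rewrite -(natr1 n.+1) -lgam_recursion// IH -EFinM -natrM factS.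
Qed.

Lemma measurable_lgam (a : R) : measurable_fun setT (fun t : R => (expR (a * t - expR t))%:E).
Proof.
by under eq_fun do rewrite -[expR _ in X in expR X]mul1r;
  exact: measurable_lgam_integrand.
Qed.

(** For n >= a, the integrand at a + 1 is below that at n + 1 where t >= 0 and below that at 1 where
    t < 0, both with known integrals. The recursion then descends from a + 1 to a. *)
Lemma lgam_fin (a : R) : (0 < a)%R -> lgam a \is a fin_num.
Proof.
move=> a0.
have ge0 b : 0 <= lgam b by apply: integral_ge0 => t _; rewrite lee_fin expR_ge0.
suff : lgam (a + 1) < +oo.
  rewrite -lgam_recursion// => h; rewrite ge0_fin_numE//.
  rewrite ltey; apply/eqP => E; move: h; rewrite E.
  by rewrite gt0_muley ?lte_fin// ltxx.
pose n := Num.bound a.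
have an : (a <= n%:R)%R by exact/ltW/unstable.ltr_bound.
apply: (@le_lt_trans _ _ (lgam 1 + lgam n.+1%:R)); last first.
  by rewrite lgam1 lgam_nat -EFinD ltry.
rewrite /lgam -ge0_integralD//=; last 2 first.
- exact: measurable_lgam.
- exact: measurable_lgam.
apply: ge0_le_integral => //=.
- exact: measurable_lgam.
- by apply: emeasurable_funD; exact: measurable_lgam.
move=> t _; rewrite -EFinD lee_fin !expRD -mulrDl ler_wpM2r ?expR_ge0//.
have [t0|t0] := lerP 0%R t.
  rewrite -[leLHS]add0r lerD ?expR_ge0// ler_expR -natr1 ler_wpM2r// lerD2r//.
rewrite -[leLHS]addr0 lerD ?expR_ge0// ler_expR ler_wnM2r ?(ltW t0)//.
by rewrite lerDr ltW.
Qed.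

Lemma lgam_gt0 (a : R) : (0 < a)%R -> 0 < lgam a.
Proof.
move=> a0.
apply: (@lt_le_trans _ _ (\int[mu]_(t in `[0%R, 1%R]) (expR (- expR 1))%:E)).
  rewrite integral_cst//= lebesgue_measure_itv/= lte_fin ltr01 oppr0 adde0 mule1.
  by rewrite lte_fin expR_gt0.
apply: (@le_trans _ _ (\int[mu]_(t in `[0%R, 1%R]) (expR (a * t - expR t))%:E)).
  apply: ge0_le_integral => //=.
  - by apply: measurable_funTS; exact: measurable_lgam.
  move=> t; rewrite in_itv/= => /andP[t0 t1]; rewrite lee_fin ler_expR.
  by rewrite -[leLHS]add0r lerD ?mulr_ge0 ?(ltW a0)// lerN2 ler_expR.
by apply: ge0_subset_integral => //=; exact: measurable_lgam.
Qed.

Lemma EFin_Gamma (z : R) : (0 < z)%R -> (Gamma z)%:E = lgam z.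
Proof.
by move=> z0; rewrite /Gamma /Rintegral integral_gamma fineK ?lgam_fin.
Qed.

Lemma Gamma_gt0 (z : R) : (0 < z)%R -> (0 < Gamma z)%R.
Proof. by move=> z0; rewrite -lte_fin EFin_Gamma// lgam_gt0. Qed.

Lemma Gamma_recursion (z : R) : (0 < z)%R -> (Gamma (z + 1) = z * Gamma z)%R.
Proof.
move=> z0; apply: EFin_inj.
by rewrite EFinM !EFin_Gamma ?addr_gt0// lgam_recursion.
Qed.

End log_gamma_integral.

(** * Radial integration and the Macdonald moments *)

Section moments.
Variable R : realType.
Local Notation mu := (@lebesgue_measure R).
Local Open Scope ereal_scope.
Local Notation lgam := (@lgam R).

Lemma integral_oneDsqrV : \int[mu]_u ((1 + u ^+ 2)^-1)%:E = (pi : R)%:E.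
Proof.
have m1 : measurable_fun setT (fun u : R => ((1 + u ^+ 2)^-1)%:E).
  by apply/measurable_EFinP; apply: continuous_measurable_fun;
    exact: continuous_oneDsqrV.
have p1 (u : R) : (0 <= (1 + u ^+ 2)^-1)%R by rewrite invr_ge0 addr_ge0// sqr_ge0.
rewrite ge0_integral_even//; last by move=> u; rewrite sqrrN.
rewrite integral_itv_obnd_cbnd; last exact: measurable_funTS.
rewrite (integral0y_oneDsqr R) -EFinM; congr EFin.
by field.
Qed.

Definition r2 (p : R * R) : R := (p.1 ^+ 2 + p.2 ^+ 2)%R.

Lemma measurable_r2 : measurable_fun setT r2.
Proof. by apply: measurable_funD; exact: measurable_funX. Qed.

(** With x = y u, the radius squared is y^2 (1 + u^2) and the Jacobian |y|. For fixed u, the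
    variable s = y^2 (1 + u^2) leaves J / (1 + u^2), and 1 / (1 + u^2) integrates to pi. *)
Lemma ge0_integral_radial (F : R -> R) : (forall s, (0 <= F s)%R) ->
  (forall s, (0 < s)%R -> {for s, continuous F}) -> measurable_fun setT F ->
  \int[mu \x mu]_p (F (r2 p))%:E =
  (pi : R)%:E * \int[mu]_(s in `]0%R, +oo[) (F s)%:E.
Proof.
move=> F0 cF mF.
have mH : measurable_fun setT (fun p : R * R => (F (r2 p))%:E).
  by apply/measurable_EFinP; apply: measurableT_comp => //; exact: measurable_r2.
have H0 p : 0 <= (F (r2 p))%:E by rewrite lee_fin.
pose K (p : R * R) : \bar R := (`|p.2| * F (p.2 ^+ 2 * (1 + p.1 ^+ 2)))%:E.
have mK : measurable_fun setT K.
  apply/measurable_EFinP; apply: measurable_funM.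
    by apply: measurableT_comp => //; exact: measurable_normr.
  apply: (measurableT_comp mF); apply: measurable_funM; first exact: measurable_funX.
  by apply: measurable_funD => //; exact: measurable_funX.
have K0 p : 0 <= K p by rewrite lee_fin mulr_ge0.
rewrite (ge0_integral_plane2 mH H0).
transitivity (\int[mu]_y \int[mu]_u K (u, y)).
  apply: ae_eq_integral => //.
  - exact: (@measurable_fun_fubini_tonelli_G _ _ (measurableTypeR R) (measurableTypeR R) R mu _ mH H0).
  - exact: (@measurable_fun_fubini_tonelli_G _ _ (measurableTypeR R) (measurableTypeR R) R mu _ mK K0).
  (* The substitution x = y u degenerates on the null line y = 0. *)
  exists [set 0%R]; split => //; first exact: lebesgue_measure_set1.
  move=> y /= Hy; apply/eqP/negPn/negP => y0; apply: Hy => _.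
  have mg : measurable_fun setT (fun x : R => (F (r2 (x, y)))%:E).
    exact: measurable_fun_pair1 mH.
  transitivity (\int[mu]_u (`|y|%:E * (F (r2 (y * u + 0, y)%R))%:E)).
    rewrite ge0_integralZl_EFin//.
      rewrite (@ge0_integral_affine _ y 0 (fun x => (F (r2 (x, y)))%:E))//.
      by rewrite muleA -EFinM divff ?normr_eq0// mul1e.
    by apply: (measurableT_comp mg); apply: measurable_funD.
  apply: eq_integral => u _; rewrite /K /r2 /= -EFinM addr0.
  by congr (_ * F _)%:E; ring.
rewrite -(ge0_integral_plane2 mK K0) (ge0_integral_plane1 mK K0).
have mG c : measurable_fun setT (fun t : R => (F (c * expR t))%:E).
  apply/measurable_EFinP; apply: (measurableT_comp mF).
  by apply: measurable_funM => //; exact: measurable_expR.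
set J := \int[mu]_(s in `]0%R, +oo[) (F s)%:E.
have J0 : 0 <= J by apply: integral_ge0 => s _; rewrite lee_fin.
transitivity (\int[mu]_u (((1 + u ^+ 2)^-1)%:E * J)).
  apply: eq_integral => u _; set w : R := (1 + u ^+ 2)%R.
  have w0 : (0 < w)%R by rewrite /w ltr_pwDl// sqr_ge0.
  have mKu : measurable_fun setT (fun y => K (u, y)) by exact: measurable_fun_pair2.
  rewrite ge0_integral_even//; last by move=> y; rewrite /K /= normrN sqrrN.
  transitivity (2%:E * \int[mu]_(y in `]0%R, +oo[) (y * F (y ^+ 2 * w))%:E).
    congr (_ * _); apply: eq_integral => y; rewrite inE/= in_itv/= andbT => y0.
    by rewrite /K /= gtr0_norm.
  rewrite (ge0_integral_expR (G := fun y => y * F (y ^+ 2 * w))%R); last 3 first.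
  - by move=> y y0; rewrite mulr_ge0// ltW.
  - move=> y y0; apply: continuousM => //.
    apply: continuous_comp.
      have -> : (fun x => x ^+ 2 * w)%R = (fun x => x * x * w)%R :> (R -> R).
        by apply/funext => x; rewrite expr2.
      apply: continuousM; last exact: cst_continuous.
      by apply: continuousM; exact: cvg_id.
    by apply: cF; rewrite mulr_gt0// exprn_gt0.
  - apply: measurable_funM => //; apply: (measurableT_comp mF).
    by apply: measurable_funM => //; exact: measurable_funX.
  rewrite /J (ge0_integral_expR (G := F))//.
  pose H (t : R) : \bar R := (F (expR t) * expR t)%:E.
  have mHt : measurable_fun setT H.
    apply/measurable_EFinP/measurable_funM; last exact: measurable_expR.
    by apply: (measurableT_comp mF); exact: measurable_expR.
  have HH0 t : 0 <= H t by rewrite lee_fin mulr_ge0// expR_ge0.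
  (* With y = e^t, y^2 w = e^(2 t + ln w); the Jacobian 1/2 of this affine map cancels the 2 coming
     from evenness in y. *)
  transitivity (2%:E * \int[mu]_t ((w^-1)%:E * H (2 * t + ln w)%R)).
    congr (_ * _); apply: eq_integral => t _; rewrite /H -EFinM.
    have -> : (2 * t + ln w = t + t + ln w)%R by ring.
    rewrite !expRD lnK ?posrE// expr2; congr EFin.
    by field; rewrite gt_eqF.
  rewrite ge0_integralZl_EFin//; last 2 first.
  - by apply: (measurableT_comp mHt); apply: measurable_funD.
  - by rewrite invr_ge0 ltW.
  rewrite ge0_integral_affine// gtr0_norm// muleCA; congr (_ * _).
  by rewrite muleA -EFinM divff// mul1e.
under eq_integral do rewrite muleC.
rewrite ge0_integralZl//=; last 2 first.
- by apply/measurable_EFinP; apply: continuous_measurable_fun;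
    exact: continuous_oneDsqrV.
- by move=> u _; rewrite lee_fin invr_ge0 addr_ge0// sqr_ge0.
by rewrite integral_oneDsqrV muleC.
Qed.


Lemma measurable_cosh : measurable_fun setT (@cosh R).
Proof.
apply: measurable_funM => //; apply: measurable_funD; first exact: measurable_expR.
by apply: measurableT_comp; [exact: measurable_expR|exact: oppr_measurable].
Qed.

Lemma cosh_gt0 (t : R) : (0 < cosh t)%R.
Proof. by rewrite /cosh divr_gt0// addr_gt0// expR_gt0. Qed.

Lemma measurable_fun_lin (c d : R) : measurable_fun setT (fun t : R => c * t + d)%R.
Proof. by apply: measurable_funD => //; exact: measurable_funM. Qed.

(** Twice Mac_alpha(x) for x > 0: over the whole line e^(alpha t) and cosh (alpha t) have the same
    integral, and a single exponential is easier to substitute into. *)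
Definition full_macdonald (alpha x : R) : \bar R :=
  \int[mu]_t (expR (alpha * t - x * cosh t))%:E.

Lemma full_macdonald_ge0 alpha x : 0 <= full_macdonald alpha x.
Proof. by apply: integral_ge0 => t _; rewrite lee_fin expR_ge0. Qed.

Lemma measurable_macdonald_integrand d (T : measurableType d) (alpha : R)
    (f g : T -> R) : measurable_fun setT f -> measurable_fun setT g ->
  measurable_fun setT (fun p => expR (alpha * g p - f p * cosh (g p))).
Proof.
move=> mf mg; apply: measurableT_comp; first exact: measurable_expR.
apply: measurable_funB; first exact: measurable_funM.
by apply: measurable_funM => //; exact: measurableT_comp measurable_cosh mg.
Qed.

Lemma measurable_full_macdonald alpha : measurable_fun setT (full_macdonald alpha).
Proof.
have mh : measurable_fun setT (fun p : R * R =>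
    (expR (alpha * p.2 - p.1 * cosh p.2))%:E).
  by apply/measurable_EFinP; exact: measurable_macdonald_integrand.
exact: (@measurable_fun_fubini_tonelli_F _ _ (measurableTypeR R)
  (measurableTypeR R) R mu _ mh (fun p => _)).
Qed.

(** Lets Tonelli exchange the plane with the line of the Macdonald integral. *)
Lemma sigma_finite_plane : sigma_finite setT (mu \x mu).
Proof.
pose B n := [set` `[(- n%:R)%R : R, (n%:R)%R]].
exists (fun n => B n `*` B n).
  apply/esym/seteqP; split => // -[x y] _.
  exists (Num.bound (`|x| + `|y|)) => //; split; rewrite /B /= in_itv/= -ler_norml;
    apply: le_trans (ltW (unstable.ltr_bound _)).
    by rewrite lerDl.
  by rewrite lerDr.
move=> n; split; first by apply: measurableX; exact: measurable_itv.
rewrite product_measure1E; [|exact: measurable_itv|exact: measurable_itv].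
have Bn : mu (B n) \is a fin_num by rewrite /B lebesgue_measure_itv; case: ifP.
suff : mu (B n) * mu (B n) < +oo by [].
by rewrite ltey_eq fin_numM.
Qed.

(* Substituting [s = e^tau], then [tau -> sigma - t] and [t -> (sigma - q) / 2]
   separates the triple integral into two Gamma integrals. *)
Lemma full_macdonald_moment (alpha nu : R) :
  \int[mu \x mu]_p ((r2 p `^ nu)%:E * full_macdonald alpha (r2 p)) =
  (pi * 2 `^ nu)%:E *
  (lgam ((nu + 1 + alpha) / 2) * lgam ((nu + 1 - alpha) / 2)).
Proof.
set a := ((nu + 1 + alpha) / 2)%R; set b := ((nu + 1 - alpha) / 2)%R.
pose K (z : (R * R) * R) : \bar R :=
  (r2 z.1 `^ nu * expR (alpha * z.2 - r2 z.1 * cosh z.2))%:E.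
have mr21 : measurable_fun setT (fun z : (R * R) * R => r2 z.1).
  by apply: measurableT_comp => //; exact: measurable_r2.
have mK : measurable_fun setT K.
  apply/measurable_EFinP; apply: measurable_funM.
    exact: (measurableT_comp (measurable_powR nu) mr21).
  exact: measurable_macdonald_integrand.
have K0 z : 0 <= K z by rewrite lee_fin mulr_ge0 ?powR_ge0 ?expR_ge0.
pose G (z : R * R) : \bar R :=
  (expR (alpha * z.1 + (nu + 1) * z.2 - cosh z.1 * expR z.2))%:E.
have mG : measurable_fun setT G.
  apply/measurable_EFinP; apply: measurableT_comp; first exact: measurable_expR.
  apply: measurable_funB.
    by apply: measurable_funD; exact: measurable_funM.
  apply: measurable_funM; first exact: measurableT_comp measurable_cosh _.
  by apply: measurableT_comp; first exact: measurable_expR.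
have G0 z : 0 <= G z by rewrite lee_fin expR_ge0.
(* Since 2 cosh t e^(sigma - t) = e^sigma + e^(sigma - 2 t), the variables sigma and q = sigma - 2 t
   decouple, with exponents a and b. *)
pose G2 (z : R * R) : \bar R :=
  (expR ((alpha - (nu + 1)) * z.1 + (nu + 1) * z.2
     - 2^-1 * (expR z.2 + expR (- 2 * z.1 + z.2))))%:E.
have mG2 : measurable_fun setT G2.
  apply/measurable_EFinP; apply: measurableT_comp; first exact: measurable_expR.
  apply: measurable_funB.
    by apply: measurable_funD; exact: measurable_funM.
  apply: measurable_funM => //; apply: measurable_funD.
    by apply: measurableT_comp; first exact: measurable_expR.
  apply: measurableT_comp; first exact: measurable_expR.
  by apply: measurable_funD => //; exact: measurable_funM.
have G20 z : 0 <= G2 z by rewrite lee_fin expR_ge0.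
have L0 x : 0 <= lgam x by apply: integral_ge0 => t _; rewrite lee_fin expR_ge0.
have ln12 : (ln (2^-1) = - ln 2 :> R)%R by rewrite lnV// posrE.
transitivity (\int[mu \x mu]_p \int[mu]_t K (p, t)).
  apply: eq_integral => p _; rewrite /full_macdonald -ge0_integralZl_EFin//.
  - by apply/measurable_EFinP; exact: measurable_macdonald_integrand.
  - exact: powR_ge0.
transitivity (\int[mu]_t \int[mu \x mu]_p K (p, t)).
  pose M : {sigma_finite_measure set (measurableTypeR R * measurableTypeR R)%type
      -> \bar R} := HB.pack (mu \x mu)
    (Measure_isSigmaFinite.Build _ _ _ (mu \x mu) sigma_finite_plane).
  exact: (@fubini_tonelli _ _ (measurableTypeR R * measurableTypeR R)%type
    (measurableTypeR R) R M mu K mK K0).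
transitivity (\int[mu]_t ((pi : R)%:E * \int[mu]_s G (t, s))).
  apply: eq_integral => t _.
  rewrite (ge0_integral_radial
    (F := fun s => s `^ nu * expR (alpha * t - s * cosh t))%R); last 3 first.
  - by move=> s; rewrite mulr_ge0 ?powR_ge0 ?expR_ge0.
  - move=> s s0; apply: continuousM.
      apply: differentiable_continuous; apply/derivable1_diffP.
      by have [] := @is_derive1_powR R nu s s0.
    apply: continuous_comp; last exact: continuous_expR.
    by apply: continuousB => //; apply: continuousM => //; exact: cst_continuous.
  - apply: measurable_funM; first exact: measurable_powR.
    exact: measurable_macdonald_integrand.
  congr (_ * _); rewrite (ge0_integral_expR
    (G := fun s => s `^ nu * expR (alpha * t - s * cosh t))%R).
  - apply: eq_integral => s _; rewrite /G /powR gt_eqF ?expR_gt0// expRK -!expRD.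
    by congr (expR _)%:E => /=; ring.
  - by move=> s s0; rewrite mulr_ge0 ?powR_ge0 ?expR_ge0.
  - move=> s s0; apply: continuousM.
      apply: differentiable_continuous; apply/derivable1_diffP.
      by have [] := @is_derive1_powR R nu s s0.
    apply: continuous_comp; last exact: continuous_expR.
    by apply: continuousB => //; apply: continuousM => //; exact: cst_continuous.
  - apply: measurable_funM; first exact: measurable_powR.
    exact: measurable_macdonald_integrand.
rewrite ge0_integralZl_EFin//; last 3 first.
- by move=> t _; exact: integral_ge0.
- exact: (@measurable_fun_fubini_tonelli_F _ _ (measurableTypeR R)
    (measurableTypeR R) R mu _ mG G0).
- exact: pi_ge0.
rewrite EFinM -muleA; congr (_ * _).
transitivity (\int[mu]_t \int[mu]_s G2 (t, s)).
  apply: eq_integral => t _.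
  have mGt : measurable_fun setT (fun s => G (t, s)) by exact: measurable_fun_pair2.
  rewrite -[LHS]mul1e -[X in X%:E * _]invr1 -[X in (X^-1)%:E * _](normr1 R).
  rewrite -(ge0_integral_affine (- t)%R (oner_neq0 R) mGt)//.
  apply: eq_integral => s _; rewrite /G /G2 /= mul1r; congr (expR _)%:E.
  have e1 : (expR s = expR t * expR (s - t))%R by rewrite -expRD; congr expR; ring.
  have e2 : (expR (- 2 * t + s) = expR (- t) * expR (s - t))%R.
    by rewrite -expRD; congr expR; ring.
  by rewrite e1 e2 /cosh; field.
rewrite -(ge0_integral_plane1 mG2 G20) (ge0_integral_plane2 mG2 G20).
(* 2^-1 is the Jacobian of q = sigma - 2 t, and 2^b comes from rescaling e^q / 2. With the later 2^a
   the constant is 2^(a + b - 1) = 2^nu. *)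
pose C : \bar R := (2^-1 * expR (b * ln 2))%:E * lgam b.
have C0 : 0 <= C by rewrite mule_ge0// lee_fin mulr_ge0// expR_ge0.
transitivity (\int[mu]_s (C * (expR (a * s - 2^-1 * expR s))%:E)).
  apply: eq_integral => s _.
  pose g (q : R) : \bar R := (expR (a * s - 2^-1 * expR s))%:E *
    (expR (b * q - 2^-1 * expR q))%:E.
  have mg : measurable_fun setT g.
    by apply: emeasurable_funM => //; exact: measurable_lgam_integrand.
  have g0 q : 0 <= g q by rewrite mule_ge0// lee_fin expR_ge0.
  transitivity (\int[mu]_t g (- 2 * t + s)%R).
    apply: eq_integral => t _; rewrite /G2 /g -EFinM -expRD /=.
    by congr (expR _)%:E; rewrite /a /b; field.
  rewrite ge0_integral_affine//.
  rewrite normrN gtr0_norm// /g ge0_integralZl_EFin//; last first.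
    exact: measurable_lgam_integrand.
  rewrite lgam_scale// ln12 mulrNN /C !muleA -!EFinM [RHS]muleAC -EFinM.
  by congr (_%:E * _); ring.
rewrite ge0_integralZl//=; last exact: measurable_lgam_integrand.
rewrite lgam_scale// ln12 mulrNN /C muleACA -EFinM; congr (_%:E * _).
  rewrite -mulrA -expRD /powR gt_eqF//.
  have -> : (b * ln 2 + a * ln 2 = ln 2 + nu * ln 2 :> R)%R by rewrite /a /b; field.
  by rewrite expRD lnK ?posrE// mulrA mulVf// mul1r.
by rewrite muleC.
Qed.

(** The integrand is even, and it is the mean of the integrand of [full_macdonald] and its
    reflection under t -> -t. *)
Lemma full_macdonaldE (alpha x : R) :
  \int[mu]_(t in `]0%R, +oo[) (expR (- (x * cosh t)) * cosh (alpha * t))%:E =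
  (2^-1)%:E * full_macdonald alpha x.
Proof.
have coshN (t : R) : cosh (- t) = cosh t by rewrite /cosh opprK addrC.
pose f (t : R) : \bar R := (expR (- (x * cosh t)) * cosh (alpha * t))%:E.
have mf : measurable_fun setT f.
  apply/measurable_EFinP; apply: measurable_funM.
    apply: measurableT_comp; first exact: measurable_expR.
    apply: measurableT_comp; first exact: oppr_measurable.
    by apply: measurable_funM => //; exact: measurable_cosh.
  apply: (measurableT_comp measurable_cosh); exact: measurable_funM.
have f0 t : 0 <= f t by rewrite lee_fin mulr_ge0 ?expR_ge0// ltW// cosh_gt0.
have H : \int[mu]_t f t = 2%:E * \int[mu]_(t in `]0%R, +oo[) f t.
  by apply: ge0_integral_even => // t; rewrite /f coshN mulrN coshN.
pose g (t : R) : \bar R := (expR (alpha * t - x * cosh t))%:E.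
have mg : measurable_fun setT g.
  by apply/measurable_EFinP; exact: measurable_macdonald_integrand.
have g0 t : 0 <= g t by rewrite lee_fin expR_ge0.
have N1 : (-1 != 0 :> R)%R by rewrite oppr_eq0 oner_neq0.
have H2 : \int[mu]_t f t = full_macdonald alpha x.
  transitivity (\int[mu]_t ((2^-1)%:E * (g t + g (- 1 * t + 0)%R))).
    apply: eq_integral => t _; rewrite /f /g -EFinD -EFinM addr0 mulN1r coshN.
    by rewrite !expRD mulrN /cosh; congr EFin; field.
  have mgN : measurable_fun setT (fun t : R => g (- 1 * t + 0)%R).
    by apply: (measurableT_comp mg); exact: measurable_fun_lin.
  rewrite ge0_integralZl_EFin//; last 2 first.
  - by move=> t _; rewrite adde_ge0.
  - exact: emeasurable_funD.
  rewrite ge0_integralD// ge0_integral_affine// normrN1 invr1 mul1e.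
  rewrite -/(full_macdonald alpha x) -mule2n -mule_natl muleA -EFinM.
  by rewrite mulVf// mul1e.
by rewrite -H2 H muleA -EFinM mulVf// mul1e.
Qed.

End moments.

(** * Slice regularity of powers *)

Section regularity_of_powers.
Variable R : realType.

(** Registered so that the rules for differentials of bilinear maps apply to the product. *)
Lemma quat_mul_bilinear :
  bilinear_for
    (GRing.Scale.Law.clone _ _ ( *:%R : R -> quat R -> quat R) _)
    (GRing.Scale.Law.clone _ _ ( *:%R : R -> quat R -> quat R) _)
    (@quat_mul R).
Proof.
split=> [u'|u] a x y.
- have E : (a *: x + y) * u' = a *: (x * u') + y * u' by rewrite mulrDl scalerAl.
  exact: E.
- have E : u * (a *: x + y) = a *: (u * x) + u * y by rewrite mulrDr scalerAr.
  exact: E.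
Qed.
HB.instance Definition _ := bilinear_isBilinear.Build R (quat R) (quat R) (quat R)
  _ _ (@quat_mul R) quat_mul_bilinear.

Lemma quat_mul_continuous : continuous (fun q : quat R * quat R => q.1 * q.2).
Proof.
move=> [p q]; apply/cvgrPdist_le => e e0.
pose M := 1 + `|p| + `|q|.
have M0 : 0 < M by rewrite /M -addrA ltr_pwDl// addr_ge0.
have near_dist (u : quat R) d : 0 < d -> nbhs u [set u' | `|u - u'| <= d].
  by move=> d0; have /cvgrPdist_le := @cvg_id _ (nbhs u); apply.
near=> z => /=.
have h1 : `|p - z.1| <= e / (2 * M).
  near: z; exists ([set u | `|p - u| <= e / (2 * M)], setT) => /=.
    by split; [apply: near_dist; rewrite divr_gt0// mulr_gt0|exact: filterT].
  by move=> [? ?] [].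
have h2 : `|q - z.2| <= e / (2 * M).
  near: z; exists (setT, [set u | `|q - u| <= e / (2 * M)]) => /=.
    by split; [exact: filterT|apply: near_dist; rewrite divr_gt0// mulr_gt0].
  by move=> [? ?] [].
have h3 : `|q - z.2| <= 1.
  near: z; exists (setT, [set u | `|q - u| <= 1]) => /=.
    by split; [exact: filterT|exact: near_dist].
  by move=> [? ?] [].
have z2 : `|z.2| <= M.
  rewrite -[z.2](subKr q) (le_trans (ler_normB _ _))// /M -addrA addrC -addrA.
  by have := normr_ge0 p; lra.
have -> : p * q - z.1 * z.2 = (p - z.1) * z.2 + p * (q - z.2).
  by rewrite mulrBl mulrBr [RHS]addrC subrKA.
rewrite (le_trans (ler_normD _ _))// !quat_normM.
have pM : `|p| <= M by rewrite /M addrAC lerDr addr_ge0.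
have k1 : `|p - z.1| * `|z.2| <= e / (2 * M) * M by apply: ler_pM.
have k2 : `|p| * `|q - z.2| <= M * (e / (2 * M)) by apply: ler_pM.
apply: le_trans (lerD k1 k2) _.
rewrite le_eqVlt; apply/orP; left; apply/eqP; field.
by rewrite gt_eqF.
Unshelve. all: by end_near. Qed.

Let mul2 (p : quat R * quat R) := quat_mul p.1 p.2.

Let differentiable_mul2 p : differentiable mul2 p.
Proof. exact: differentiable_bilin quat_mul_continuous. Qed.

Lemma differentiable_quat_mul (V : normedModType R) (f g : V -> quat R) x :
  differentiable f x -> differentiable g x ->
  differentiable (fun y => f y * g y) x.
Proof.
move=> df dg.
rewrite -[fun y => _]/(mul2 \o (fun y => (f y, g y))).
by apply: differentiable_comp; first exact: differentiable_pair.
Qed.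

Lemma diff_quat_mul (V : normedModType R) (f g : V -> quat R) x v :
  differentiable f x -> differentiable g x ->
  'd (fun y => f y * g y) x v = f x * 'd g x v + 'd f x v * g x.
Proof.
move=> df dg.
rewrite -[fun y => _]/(mul2 \o (fun y => (f y, g y))).
have dp := differentiable_pair df dg.
have E1 := congr1 (fun h : V -> quat R => h v)
  (diff_comp dp (differentiable_mul2 (f x, g x))).
have E2 := congr1 (fun h : quat R * quat R -> quat R => h ('d f x v, 'd g x v))
  (diff_bilin (f x, g x) quat_mul_continuous).
have E3 := congr1 (fun h : V -> quat R * quat R => 'd mul2 (f x, g x) (h v))
  (diff_pair df dg).
apply: etrans E1 _; apply: etrans E3 _; exact: E2.
Qed.

Lemma differentiable_quatX (V : normedModType R) (f : V -> quat R) x n :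
  differentiable f x -> differentiable (fun y => f y ^+ n) x.
Proof.
move=> df; elim: n => [|n IH].
  by under eq_fun do rewrite expr0; exact: differentiable_cst.
by under eq_fun do rewrite exprS; exact: differentiable_quat_mul.
Qed.

Variable I : quat R.
Hypothesis hI : imag_sphere I.

Lemma slice_differentiable p : differentiable (slice I) p.
Proof.
pose LM := GRing.isLinear.Build _ _ _ _ _ (@slice_linear R I).
pose L : {linear (R * R)%type -> quat R} := HB.pack (slice I) LM.
apply: (@linear_differentiable _ _ _ L).
exact: lipschitz_linear_continuous (@slice_linear R I) (@slice_bounded R I).
Qed.

Lemma slice_diff p v : 'd (slice I) p v = slice I v.
Proof.
pose LM := GRing.isLinear.Build _ _ _ _ _ (@slice_linear R I).
pose L : {linear (R * R)%type -> quat R} := HB.pack (slice I) LM.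
have cL : continuous L.
  exact: lipschitz_linear_continuous (@slice_linear R I) (@slice_bounded R I).
by rewrite -[slice I]/(L : _ -> _) diff_lin.
Qed.

(** The commutative power rule, valid because increments inside C_I commute with the base point. *)
Lemma diff_sliceX n p v : 'd (fun p => slice I p ^+ n) p v =
  n%:R *: (slice I p ^+ n.-1 * slice I v).
Proof.
elim: n => [|n IH].
  under eq_fun do rewrite expr0.
  by rewrite diff_cst scale0r.
under eq_fun do rewrite exprS.
have ds := slice_differentiable p.
transitivity (slice I p * (n%:R *: (slice I p ^+ n.-1 * slice I v))
    + slice I v * slice I p ^+ n).
  rewrite (diff_quat_mul v ds (differentiable_quatX n ds)).
  by congr (_ * _ + _ * _); [exact: IH|exact: slice_diff].
rewrite succnK; case: n {IH} => [|n].
  by rewrite scale0r mulr0 add0r expr0 mulr1 mul1r scale1r.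
rewrite -scalerAr mulrA -exprS -[n.+2%:R]natr1 scalerDl scale1r; congr (_ + _).
rewrite -/(GRing.comm _ _); apply: commrX.
exact: slice_comm.
Qed.

Lemma sliceX_continuous n : continuous (fun p => slice I p ^+ n).
Proof.
move=> p; apply: differentiable_continuous.
by apply: differentiable_quatX; exact: slice_differentiable.
Qed.

Lemma quat_mull_continuous (u : quat R) : continuous (fun q => u * q).
Proof.
exact: lipschitz_linear_continuous (@quat_mull_linear R u) (@quat_mull_bounded R u).
Qed.

End regularity_of_powers.

Lemma slice_regular_monomial (R : realType) (c : R) (n : nat) :
  slice_regular (fun q : quat R => c *: q ^+ n).
Proof.
split=> [q|I hI].
  apply: differentiableZ; apply: differentiable_quatX; exact: ex_diff.
pose g p := slice I p ^+ n.
have dg p : differentiable g p.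
  by apply: differentiable_quatX; exact: slice_differentiable.
have df p : differentiable (restrict_slice I (fun q : quat R => c *: q ^+ n)) p.
  exact: (differentiableZ (f := g)).
have D v p : 'D_v (restrict_slice I (fun q : quat R => c *: q ^+ n)) p =
    (c * n%:R) *: (slice I v * slice I p ^+ n.-1).
  rewrite deriveE// (diffZ (f := g))//= (diff_sliceX hI) scalerA; congr (_ *: _).
  rewrite -/(GRing.comm _ _); apply/commr_sym/commrX; exact: slice_comm.
have cD v : continuous (fun p => (c * n%:R) *: (slice I v * slice I p ^+ n.-1)).
  move=> p; apply: cvgZr; apply: continuous_comp; first exact: sliceX_continuous.
  exact: quat_mull_continuous.
split.
- by move=> p v _; exact: diff_derivable.
- by move=> p; under eq_fun do rewrite D; exact: cD.
- by move=> p; under eq_fun do rewrite D; exact: cD.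
- move=> p; rewrite !D.
  rewrite /slice /= !(scale0r, scale1r, addr0, add0r) mul1r -scalerAr mulrA.
  by rewrite sqr_imag_sphere// mulN1r scalerN subrr scaler0.
Qed.

(** * Weighted square norms on a slice *)

Section density.
Variables (R : realType) (I : quat R).
Hypothesis hI : imag_sphere I.
Local Notation mu := (@lebesgue_measure R).

Lemma sqr_norm_slice_r2 p : `|slice I p| ^+ 2 = r2 p.
Proof. exact: sqr_norm_slice. Qed.

Lemma r2_ge0 (p : R * R) : 0 <= r2 p.
Proof. by rewrite addr_ge0// sqr_ge0. Qed.

Lemma r2_rotp t (p : R * R) : r2 (rotp t p) = r2 p.
Proof. by rewrite -!sqr_norm_slice_r2 norm_rot. Qed.

Lemma fock_density_slice alpha p : fock_density alpha (slice I p) =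
  r2 p `^ (alpha + 1) / (pi * 2 `^ alpha * Gamma (alpha + 1)) *
  fine (2^-1%:E * full_macdonald alpha (r2 p))%E.
Proof.
rewrite /fock_density sqr_norm_slice_r2 /macdonald /Rintegral full_macdonaldE.
by rewrite -sqr_norm_slice_r2 -powR_mulrn// -powRrM mulrDr mulr1.
Qed.

Lemma fock_density_rotp alpha t p :
  fock_density alpha (slice I (rotp t p)) = fock_density alpha (slice I p).
Proof. by rewrite !fock_density_slice r2_rotp. Qed.

Lemma fock_density_ge0 alpha p : -1 < alpha -> 0 <= fock_density alpha (slice I p).
Proof.
move=> a1; have a0 : 0 < alpha + 1 by lra.
rewrite fock_density_slice mulr_ge0//.
  rewrite divr_ge0 ?powR_ge0// !mulr_ge0 ?pi_ge0 ?powR_ge0//.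
  by rewrite ltW// Gamma_gt0.
by rewrite fine_ge0// mule_ge0 ?full_macdonald_ge0// lee_fin.
Qed.

Lemma measurable_fock_density alpha :
  measurable_fun setT (fun p => fock_density alpha (slice I p)).
Proof.
under eq_fun do rewrite fock_density_slice.
have mr := @measurable_r2 R.
apply: measurable_funM.
  apply: measurable_funM => //.
  exact: (measurableT_comp (measurable_powR (alpha + 1)) mr).
apply: measurableT_comp; first exact: fine_measurable.
apply: emeasurable_funM => //.
exact: (measurableT_comp (measurable_full_macdonald alpha) mr).
Qed.

(** [full_macdonald_moment] at nu = 2 k + alpha + 1, whose two Gamma arguments are then k + alpha +
    1 and k + 1. The density contains [fine], so the integrands are compared almost everywhere. *)
Lemma fock_density_moment alpha (k : nat) : -1 < alpha ->
  (\int[mu \x mu]_p (fock_density alpha (slice I p) * r2 p ^+ (2 * k))%:E)%E =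
  (2 ^+ (2 * k) * k`!%:R * Gamma (k%:R + alpha + 1) / Gamma (alpha + 1))%:E.
Proof.
move=> a1; have a0 : 0 < alpha + 1 by lra.
have G0 := Gamma_gt0 a0.
have k0 : 0 <= k%:R :> R by [].
pose nu : R := (2 * k)%:R + alpha + 1.
have nuE : nu = 2 * k%:R + alpha + 1 by rewrite /nu natrM.
have nu0 : nu != 0 by rewrite gt_eqF// nuE; lra.
pose c : R := (pi * 2 `^ alpha * Gamma (alpha + 1))^-1.
have d0 : 0 < pi * 2 `^ alpha * Gamma (alpha + 1).
  by rewrite !mulr_gt0 ?pi_gt0 ?powR_gt0.
have c0 : 0 <= c by rewrite invr_ge0 ltW.
have mr := @measurable_r2 R.
pose h (p : R * R) : \bar R := ((r2 p `^ nu)%:E * full_macdonald alpha (r2 p))%E.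
have mh : measurable_fun setT h.
  apply: emeasurable_funM.
    by apply/measurable_EFinP; exact: (measurableT_comp (measurable_powR nu) mr).
  exact: (measurableT_comp (measurable_full_macdonald alpha) mr).
have h0 p : (0 <= h p)%E by rewrite mule_ge0 ?full_macdonald_ge0// lee_fin powR_ge0.
have hint : (\int[mu \x mu]_p h p)%E =
    (pi * 2 `^ nu * (Gamma (k%:R + alpha + 1) * k`!%:R))%:E.
  rewrite full_macdonald_moment [in RHS]EFinM; congr (_ * _)%E.
  have -> : (nu + 1 + alpha) / 2 = k%:R + alpha + 1 by rewrite nuE; field.
  have -> : (nu + 1 - alpha) / 2 = k.+1%:R by rewrite nuE -natr1; field.
  by rewrite lgam_nat -EFin_Gamma ?EFinM//; lra.
pose g (p : R * R) : \bar R := ((c / 2)%:E * h p)%E.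
transitivity (\int[mu \x mu]_p g p)%E; last first.
  rewrite ge0_integralZl_EFin//; last by rewrite divr_ge0.
  rewrite hint -EFinM; congr EFin.
  have -> : 2 `^ nu = 2 ^+ (2 * k) * (2 `^ alpha * 2) :> R.
    rewrite /nu -addrA powRD ?pnatr_eq0 ?implybT// powR_mulrn// powRD ?pnatr_eq0 ?implybT//.
    by rewrite powRr1.
  have p0 : pi != 0 :> R by rewrite gt_eqF// pi_gt0.
  have q0 : 2 `^ alpha != 0 :> R by rewrite gt_eqF// powR_gt0.
  have g1 : Gamma (alpha + 1) != 0 by rewrite gt_eqF.
  rewrite /c; move: (2 ^+ (2 * k)) p0 q0 g1.
  move: (pi : R) (2 `^ alpha) (Gamma (alpha + 1)) (Gamma _) (k`!%:R : R).
  move=> P Q G G' K E P0 Q0 g1; field.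
  by rewrite P0 Q0 g1.
have mg : measurable_fun setT g by exact: emeasurable_funM.
(* The integral of h is already known to be finite, so h is finite almost everywhere. *)
have fin_h : {ae (mu \x mu)%E, forall p, h p \is a fin_num}.
  have ih : (mu \x mu)%E.-integrable setT h.
    apply/integrableP; split => //.
    under eq_integral do rewrite gee0_abs//.
    by rewrite hint ltry.
  have := integrable_ae measurableT ih.
  by apply: filterS => p; exact.
apply: ae_eq_integral => //.
  apply/measurable_EFinP; apply: measurable_funM; first exact: measurable_fock_density.
  exact: measurable_funX.
have [A [mA A0 hA]] := fin_h; exists A; split => // p /= /not_implyP[_ hp].
apply: hA => /= {}hfin; apply: hp; move: hfin => hp; rewrite /g fock_density_slice -/c.
(* At the origin both sides vanish: a nonzero power of 0 is 0, and 0 times +oo is 0. *)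
have [r0|r0] := eqVneq (r2 p) 0.
  by rewrite /h r0 !powR0// ?gt_eqF// mul0e mule0 !mul0r.
have rp : 0 < r2 p by rewrite lt_neqAle eq_sym r0 r2_ge0.
have Mfin : full_macdonald alpha (r2 p) \is a fin_num.
  rewrite ge0_fin_numE ?full_macdonald_ge0// ltey; apply/eqP => E; move: hp.
  by rewrite /h E gt0_muley// lte_fin powR_gt0.
rewrite /h -(fineK Mfin) -!EFinM /=; congr EFin.
rewrite -powR_mulrn ?ltW//.
have -> : r2 p `^ nu = r2 p `^ (alpha + 1) * r2 p `^ (2 * k)%:R.
  by rewrite -powRD ?r0 ?implybT//; congr (_ `^ _); rewrite /nu; ring.
by field.
Qed.

End density.

Section measurable_quaternion_functions.
Variables (R : realType) (d : measure_display) (T : measurableType d).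
Implicit Types F G : T -> quat R.

Definition qmeasurable F :=
  [/\ measurable_fun setT (fun x => q_re (F x)), measurable_fun setT (fun x => q_i (F x)),
      measurable_fun setT (fun x => q_j (F x)) & measurable_fun setT (fun x => q_k (F x))].

Lemma qmeasurable_cst (q : quat R) : qmeasurable (fun=> q).
Proof. by split; exact: measurable_cst. Qed.

Lemma qmeasurableD F G : qmeasurable F -> qmeasurable G ->
  qmeasurable (fun x => F x + G x).
Proof. by move=> [? ? ? ?] [? ? ? ?]; split; exact: measurable_funD. Qed.

Lemma qmeasurableB F G : qmeasurable F -> qmeasurable G ->
  qmeasurable (fun x => F x - G x).
Proof. by move=> [? ? ? ?] [? ? ? ?]; split; exact: measurable_funB. Qed.

Lemma qmeasurableM F G : qmeasurable F -> qmeasurable G ->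
  qmeasurable (fun x => F x * G x).
Proof.
move=> [? ? ? ?] [? ? ? ?]; split;
  repeat (apply: measurable_funB || apply: measurable_funD); exact: measurable_funM.
Qed.

Lemma qmeasurableX F n : qmeasurable F -> qmeasurable (fun x => F x ^+ n).
Proof.
move=> mF; elim: n => [|n IH].
  by under eq_fun do rewrite expr0; exact: qmeasurable_cst.
by under eq_fun do rewrite exprS; exact: qmeasurableM.
Qed.

Lemma qmeasurableZ (a : R) F : qmeasurable F -> qmeasurable (fun x => a *: F x).
Proof. by move=> [? ? ? ?]; split; exact: measurable_funM. Qed.

Lemma qmeasurable_conj F : qmeasurable F -> qmeasurable (fun x => quat_conj (F x)).
Proof.
move=> [? ? ? ?]; split => //;
  by apply: measurableT_comp; first exact: oppr_measurable.
Qed.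

Lemma qmeasurable_sum n (F : nat -> T -> quat R) : (forall i, qmeasurable (F i)) ->
  qmeasurable (fun x => \sum_(i < n) F i x).
Proof.
move=> mF; elim: n => [|n IH].
  by under eq_fun do rewrite big_ord0; exact: qmeasurable_cst.
by under eq_fun do rewrite big_ord_recr/=; exact: qmeasurableD.
Qed.

Lemma measurable_sqr_norm F : qmeasurable F ->
  measurable_fun setT (fun x => `|F x| ^+ 2).
Proof.
move=> [? ? ? ?]; under eq_fun do rewrite sqr_quat_norm.
by repeat apply: measurable_funD; exact: measurable_funX.
Qed.

Lemma qmeasurable_limit F (G : nat -> T -> quat R) :
  (forall n, qmeasurable (G n)) ->
  (forall x (e : R), 0 < e -> exists M, forall n, (M <= n)%N -> `|F x - G n x| <= e) ->
  qmeasurable F.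
Proof.
move=> mG GF.
have cG (c : quat R -> R) : (forall p q, c (p - q) = c p - c q) ->
    (forall q, `|c q| <= `|q|) -> (forall n, measurable_fun setT (fun x => c (G n x))) ->
    measurable_fun setT (fun x => c (F x)).
  move=> cB c1 mc; apply: (measurable_fun_cvg (h := fun n x => c (G n x))) => //.
  move=> x _; apply/cvgrPdist_le => e e0.
  have [M HM] := GF x e e0; exists M => // n Mn /=.
  by rewrite -cB (le_trans (c1 _))// HM.
split; apply: cG => //.
- by move=> q; have [] := norm_components_le q.
- by move=> n; have [] := mG n.
- by move=> q; have [] := norm_components_le q.
- by move=> n; have [] := mG n.
- by move=> q; have [] := norm_components_le q.
- by move=> n; have [] := mG n.
- by move=> q; have [] := norm_components_le q.
- by move=> n; have [] := mG n.
Qed.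

End measurable_quaternion_functions.

Lemma limn_einf_le (R : realType) (u : nat -> \bar R) (c : \bar R) (M : nat) :
  (forall n, (M <= n)%N -> (u n <= c)%E) -> (limn_einf u <= c)%E.
Proof.
move=> uc; rewrite limn_einf_lim; apply: lime_le; first exact: is_cvg_einfs.
exists M => // n /= Mn; apply: le_trans (uc n Mn).
by apply: ereal_inf_lbound; exists n => /=.
Qed.

(** Fatou's lemma in the form used below: an eventual bound on the integrals passes to the pointwise
    limit. *)
Lemma integral_limit_le d (T : measurableType d) (R : realType)
    (m : {measure set T -> \bar R}) (g : nat -> T -> \bar R) (f : T -> \bar R)
    (c : \bar R) (M : nat) :
  (forall n, measurable_fun setT (g n)) -> (forall n x, (0 <= g n x)%E) ->
  (forall x, g n x @[n --> \oo] --> f x) ->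
  (forall n, (M <= n)%N -> (\int[m]_x g n x <= c)%E) -> (\int[m]_x f x <= c)%E.
Proof.
move=> mg g0 gf gc.
have -> : (\int[m]_x f x = \int[m]_x limn_einf (g^~ x))%E.
  by apply: eq_integral => x _; have [-> _] := cvg_limn_einf_sup (gf x).
apply: (@le_trans _ _ (limn_einf (fun n => \int[m]_x g n x)%E)).
  by apply: fatou => // n x _; exact: g0.
exact: limn_einf_le gc.
Qed.

Lemma cvg_sqr (R : realType) (u : nat -> R) (l : R) :
  u n @[n --> \oo] --> l -> u n ^+ 2 @[n --> \oo] --> l ^+ 2.
Proof. by move=> ul; rewrite expr2; under eq_fun do rewrite expr2; exact: cvgM. Qed.

(** * Parseval, Bessel and tail estimates for a rotation-invariant weight *)

Section weighted_plane.
Variables (R : realType) (I : quat R).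
Hypothesis hI : imag_sphere I.
Local Notation mu := (@lebesgue_measure R).
Local Notation s := (slice I).
Implicit Types (F : R * R -> quat R) (a : nat -> quat R) (N M n : nat).

Lemma qmeasurable_slice : qmeasurable s.
Proof.
by split => /=; apply: measurable_funD; exact: measurable_funM.
Qed.

Lemma qmeasurable_rotp F t : qmeasurable F -> qmeasurable (fun p => F (rotp t p)).
Proof.
by move=> [h1 h2 h3 h4]; split;
  [move: h1|move: h2|move: h3|move: h4] => h;
  exact: (measurableT_comp h (@measurable_rotp R t)).
Qed.

Definition psum a N p : quat R := \sum_(n < N) s p ^+ n * a n.

Lemma qmeasurable_psum a N : qmeasurable (psum a N).
Proof.
apply: (qmeasurable_sum N (F := fun n p => s p ^+ n * a n)) => n.
by apply: qmeasurableM; [apply: qmeasurableX; exact: qmeasurable_slice|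
  exact: qmeasurable_cst].
Qed.

Variable w : R * R -> R.
Hypothesis w0 : forall p, 0 <= w p.
Hypothesis mw : measurable_fun setT w.
Hypothesis w_rot : forall t p, w (rotp t p) = w p.

Definition wnorm F : \bar R := (\int[mu \x mu]_p (w p * `|F p| ^+ 2)%:E)%E.
Definition wmoment n : \bar R := (\int[mu \x mu]_p (w p * r2 p ^+ n)%:E)%E.

Let mwF F : qmeasurable F -> measurable_fun setT (fun p => (w p * `|F p| ^+ 2)%:E).
Proof.
move=> mF; apply/measurable_EFinP; apply: measurable_funM => //.
exact: measurable_sqr_norm.
Qed.

Let mwr n : measurable_fun setT (fun p => (w p * r2 p ^+ n)%:E).
Proof.
apply/measurable_EFinP; apply: measurable_funM => //.
by apply: measurable_funX; exact: measurable_r2.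
Qed.

Let wF0 F p : (0 <= (w p * `|F p| ^+ 2)%:E)%E.
Proof. by rewrite lee_fin mulr_ge0// sqr_ge0. Qed.

Let wr0 n p : (0 <= (w p * r2 p ^+ n)%:E)%E.
Proof. by rewrite lee_fin mulr_ge0// exprn_ge0// r2_ge0. Qed.

(** Each rotation preserves the norm, so |F|^2 may be replaced by its orbit average, to which the
    pointwise identities on roots of unity apply. *)
Lemma wnorm_average N F : (0 < N)%N -> qmeasurable F ->
  wnorm F = (\int[mu \x mu]_p
    (w p * (N%:R^-1 * \sum_(k < N) `|F (rotp (k%:R * rang R N) p)| ^+ 2))%:E)%E.
Proof.
move=> N0 mF.
have mk (k : nat) : measurable_fun setT
    (fun p => (w p * `|F (rotp (k%:R * rang R N) p)| ^+ 2)%:E).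
  exact: (mwF (qmeasurable_rotp _ mF)).
transitivity (\int[mu \x mu]_p ((N%:R^-1)%:E *
    \sum_(k < N) (w p * `|F (rotp (k%:R * rang R N) p)| ^+ 2)%:E))%E; last first.
  apply: eq_integral => p _; rewrite sumEFin -EFinM; congr EFin.
  by rewrite -mulr_sumr mulrCA.
rewrite ge0_integralZl_EFin//; last 2 first.
- by move=> p _; apply: sume_ge0 => k _; rewrite lee_fin mulr_ge0// sqr_ge0.
- by apply: emeasurable_sum => k; exact: mk.
rewrite ge0_integral_sum//; last first.
  by move=> k p _; rewrite lee_fin mulr_ge0// sqr_ge0.
  by move=> k; exact: mk.
under eq_bigr => k _.
  rewrite (_ : (\int[_]_x _)%E = wnorm F); last first.
    rewrite /wnorm -(ge0_integral_rotp (k%:R * rang R N) (mwF mF) (wF0 F)).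
    by apply: eq_integral => p _; rewrite w_rot.
  over.
have wF : (0 <= wnorm F)%E by apply: integral_ge0 => p _; exact: wF0.
rewrite (_ : (\sum_(k < N) _)%E = N%:R%:E * wnorm F)%E; last first.
  elim: (N) => [|n IH]; first by rewrite big_ord0 mul0e.
  by rewrite big_ord_recr/= IH -natr1 EFinD ge0_muleDl ?lee_fin// mul1e.
by rewrite muleA -EFinM mulVf ?mul1e// pnatr_eq0 -lt0n.
Qed.

Lemma sumZ_wmoment M (c : nat -> R) : (forall n, 0 <= c n) ->
  (\int[mu \x mu]_p (\sum_(n < M) c n * (w p * r2 p ^+ n))%:E =
   \sum_(n < M) (c n)%:E * wmoment n)%E.
Proof.
move=> c0; transitivity (\int[mu \x mu]_p
    (\sum_(n < M) ((c n)%:E * (w p * r2 p ^+ n)%:E)))%E.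
  by apply: eq_integral => p _; rewrite -sumEFin; apply: eq_bigr => n _.
rewrite ge0_integral_sum//; last 2 first.
- move=> n; apply: emeasurable_funM => //; exact: mwr.
- by move=> n p _; rewrite mule_ge0// lee_fin.
by apply: eq_bigr => n _; rewrite ge0_integralZl_EFin//; exact: mwr.
Qed.

Lemma wnorm_psum a M :
  (wnorm (psum a M) = \sum_(n < M) (`|a n| ^+ 2)%:E * wmoment n)%E.
Proof.
(* The number of roots must be positive and at least M, including for M = 0. *)
rewrite (@wnorm_average M.+1)//; last exact: qmeasurable_psum.
rewrite -(sumZ_wmoment M (c := fun n => `|a n| ^+ 2)); last first.
  by move=> n; exact: sqr_ge0.
apply: eq_integral => p _; congr EFin.
have E k : psum a M (rotp (k%:R * rang R M.+1) p) =
    \sum_(n < M) expI I (k%:R * (n%:R * rang R M.+1)) * (s p ^+ n * a n).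
  apply: eq_bigr => n _; rewrite slice_rotX// -mulrA.
  by have -> : n%:R * (k%:R * rang R M.+1) = k%:R * (n%:R * rang R M.+1) by ring.
under eq_bigr do rewrite E.
rewrite (parseval_roots hI (fun n => s p ^+ n * a n) (leqnSn M)).
rewrite [_^-1 * _]mulrA mulVf ?pnatr_eq0// mul1r mulr_sumr; apply: eq_bigr => n _.
by rewrite quat_normM quat_normX exprMn exprAC sqr_norm_slice_r2//; ring.
Qed.

Definition power_series F a := forall rho e : R, 0 < e ->
  exists M0, forall M, (M0 <= M)%N -> forall p, `|s p| <= rho ->
    `|F p - psum a M p| <= e.

Lemma power_series_qmeasurable F a : power_series F a -> qmeasurable F.
Proof.
move=> Fa; apply: (qmeasurable_limit (G := psum a)).
  by move=> n; exact: qmeasurable_psum.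
move=> p e e0; have [M0 H] := Fa `|s p| e e0.
by exists M0 => n /H; apply.
Qed.

(** [avg] is exact on a partial sum once N is large, and it does not enlarge the uniform error on
    the circle through p. *)
Lemma avg_power_series_cvg F a n p : power_series F a ->
  avg I N.+1 n F p @[N --> \oo] --> s p ^+ n * a n.
Proof.
move=> Fa; apply/cvgrPdist_le => e e0.
have [M0 H] := Fa `|s p| e e0.
exists (maxn M0 n.+1) => // N /= MN.
have h : avg I N.+1 n (psum a (maxn M0 n.+1)) p = s p ^+ n * a n.
  rewrite avg_poly//; first by rewrite leq_max leqnn orbT.
  - by rewrite ltnS (leq_trans _ MN)// leq_max leqnSn orbT.
  - exact: leqW.
rewrite -h distrC -avgB norm_avg_le// => q qp.
by apply: H; rewrite ?leq_maxl ?qp.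
Qed.

Lemma wnorm_bessel F a M : power_series F a ->
  (\sum_(n < M) (`|a n| ^+ 2)%:E * wmoment n <= wnorm F)%E.
Proof.
move=> Fa; have mF := power_series_qmeasurable Fa.
pose g N p : \bar R := (w p * \sum_(n < M) `|avg I N.+1 n F p| ^+ 2)%:E.
have mg N : measurable_fun setT (g N).
  apply/measurable_EFinP; apply: measurable_funM => //.
  apply: measurable_sum => n; apply: measurable_sqr_norm.
  apply: qmeasurableZ; apply: (qmeasurable_sum N.+1 (F := fun k p =>
    expI I (- (k%:R * (n%:R * rang R N.+1))) * F (rotp (k%:R * rang R N.+1) p))) => k.
  by apply: qmeasurableM; [exact: qmeasurable_cst|exact: qmeasurable_rotp].
have g0 N p : (0 <= g N p)%E.
  by rewrite lee_fin mulr_ge0// sumr_ge0// => n _; exact: sqr_ge0.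
have cg p : g N p @[N --> \oo] -->
    (\sum_(n < M) `|a n| ^+ 2 * (w p * r2 p ^+ n))%:E.
  have -> : \sum_(n < M) `|a n| ^+ 2 * (w p * r2 p ^+ n) =
      w p * \sum_(n < M) `|s p ^+ n * a n| ^+ 2.
    rewrite mulr_sumr; apply: eq_bigr => n _.
    by rewrite quat_normM quat_normX exprMn exprAC sqr_norm_slice_r2//; ring.
  apply: cvg_EFin; first by near=> N.
  apply: cvgMr; elim: (M) => [|m IH].
    by rewrite big_ord0; under eq_fun do rewrite big_ord0; exact: cvg_cst.
  rewrite big_ord_recr/=; under eq_fun do rewrite big_ord_recr/=.
  by apply: cvgD => //; apply: cvg_sqr; apply: cvg_norm; exact: avg_power_series_cvg.
rewrite -(sumZ_wmoment M (c := fun n => `|a n| ^+ 2)); last first.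
  by move=> n; exact: sqr_ge0.
have H := @integral_limit_le _ _ R (mu \x mu)%E g _ (wnorm F) M mg g0 cg; apply: H => N MN.
rewrite (@wnorm_average N.+1)//.
apply: ge0_le_integral => //.
- exact: mg.
- apply/measurable_EFinP; apply: measurable_funM => //; apply: measurable_funM => //.
  apply: measurable_sum => k; apply: measurable_sqr_norm; exact: qmeasurable_rotp.
- move=> p _; rewrite lee_fin ler_wpM2l//; apply: bessel_roots => //.
  exact: leqW.
Unshelve. all: by end_near. Qed.

Lemma wnorm_tail F a N (c : \bar R) : power_series F a ->
  (forall M, \sum_(N <= n < M) (`|a n| ^+ 2)%:E * wmoment n <= c)%E ->
  (wnorm (fun p => F p - psum a N p)%R <= c)%E.
Proof.
move=> Fa Hc; have mF := power_series_qmeasurable Fa.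
(* Partial sums of the tail are partial sums for the truncated coefficients, so [wnorm_psum]
   computes their norms. *)
pose a' n := if (n < N)%N then 0 else a n.
have psumE M p : (N <= M)%N -> psum a' M p = psum a M p - psum a N p.
  move=> NM; rewrite /psum.
  have -> : \sum_(n < N) s p ^+ n * a n =
      \sum_(n < M) (if (n < N)%N then s p ^+ n * a n else 0).
    rewrite (big_ord_widen M (fun n => s p ^+ n * a n) NM) [LHS]big_mkcond/=.
    by apply: eq_bigr => n _.
  rewrite -sumrB; apply: eq_bigr => n _; rewrite /a'.
  by case: ifP; rewrite ?mulr0 ?subrr ?subr0.
pose g M p : \bar R := (w p * `|psum a' M p| ^+ 2)%:E.
have cg p : g M p @[M --> \oo] --> (w p * `|F p - psum a N p| ^+ 2)%:E.
  apply: cvg_EFin; first by near=> M.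
  apply: cvgMr; apply: cvg_sqr; apply: cvg_norm; apply/cvgrPdist_le => e e0.
  have [M0 H] := Fa `|s p| e e0.
  exists (maxn M0 N) => // M /= MM.
  rewrite psumE; last by rewrite (leq_trans _ MM)// leq_maxr.
  rewrite opprB addrA subrK; apply: H => //.
  by rewrite (leq_trans _ MM)// leq_maxl.
have mg M : measurable_fun setT (g M) by apply: mwF; exact: qmeasurable_psum.
have H := @integral_limit_le _ _ R (mu \x mu)%E g _ c N mg (fun M => wF0 (psum a' M)) cg; apply: H => M NM.
apply: le_trans (Hc M); rewrite -[leLHS]/(wnorm (psum a' M)) wnorm_psum.
rewrite -(big_mkord xpredT (fun n => (`|a' n| ^+ 2)%:E * wmoment n)%E).
rewrite (big_cat_nat (leq0n N) NM)/= big_nat_cond big1 ?add0e.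
  rewrite [leLHS]big_nat_cond [leRHS]big_nat_cond.
  rewrite (eq_bigr (fun n => (`|a n| ^+ 2)%:E * wmoment n)%E)// => n.
  by rewrite andbT /a' => /andP[Nn _]; rewrite ltnNge Nn.
move=> n; rewrite andbT /a' => /andP[_ ->].
by rewrite normr0 expr0n/= mul0e.
Unshelve. all: by end_near. Qed.

End weighted_plane.

(** * Orthonormality and density of the normalized monomials *)

Lemma fine_pmull (R : realType) (c : R) (x : \bar R) : 0 < c ->
  fine (c%:E * x)%E = c * fine x.
Proof.
by move=> c0; case: x => [r| |] //=; rewrite ?gt0_muley ?gt0_muleNy ?lte_fin//= mulr0.
Qed.

Lemma fine_le_real (R : realType) (c : R) (x : \bar R) :
  (0 <= x)%E -> (x <= c%:E)%E -> fine x <= c.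
Proof. by case: x => [r| |] //=; rewrite lee_fin. Qed.

Lemma bounded_series_tail (R : realType) (u : nat -> R) (E d : R) :
  (forall n, 0 <= u n) -> (forall M, \sum_(n < M) u n <= E) -> 0 < d ->
  exists N, forall M, \sum_(N <= n < M) u n <= d.
Proof.
move=> u0 uE d0; pose A := range (fun M => \sum_(n < M) u n).
have supA : has_sup A.
  split; first by exists (\sum_(n < 0) u n), 0%N.
  by exists E => _ [M _ <-].
have [_ [N _ <-] HN] := sup_adherent d0 supA; exists N => M.
have [NM|/ltnW MN] := leqP N M; last by rewrite big_geq// ltW.
have : \sum_(n < M) u n <= sup A by apply: sup_upper_bound => //; exists M.
rewrite -!(big_mkord xpredT u) (big_cat_nat (leq0n N) NM)/= in HN *.
by move=> h; lra.
Qed.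

Lemma q_re_scalar (R : realType) (c : R) : q_re (c%:A : quat R) = c.
Proof. by rewrite /= mulr1. Qed.

Lemma half_double (R : realType) (x : quat R) : 2^-1 *: (x + x) = x.
Proof. by rewrite -mulr2n -[x *+ 2]scaler_nat scalerA mulVf ?scale1r// pnatr_eq0. Qed.

(** * Even and odd parts *)

Section parts.
Variables (R : realType) (I : quat R).
Hypothesis hI : imag_sphere I.
Local Notation s := (slice I).
Implicit Types (f : quat R -> quat R) (a : nat -> quat R) (b : bool).

(** The boolean is the parity itself, so that q^n belongs to part b exactly when [odd n == b]. *)
Definition part b f := if b then odd_part f else even_part f.

Lemma partE b f q : part b f q = 2^-1 *: (f q + (-1) ^+ b *: f (- q)).
Proof.
by case: b; rewrite /part /odd_part /even_part ?expr0 ?scale1r ?expr1 ?scaleN1r.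
Qed.

Definition coef b a n : quat R := if odd n == b then a n else 0.

Lemma partB b f g q : part b (fun x => f x - g x) q = part b f q - part b g q.
Proof.
by rewrite !partE -[RHS]scalerBr [in LHS]scalerBr opprD addrACA.
Qed.

Lemma norm_part_le b f q (e : R) : `|f q| <= e -> `|f (- q)| <= e ->
  `|part b f q| <= e.
Proof.
move=> h1 h2; rewrite partE normrZ gtr0_norm ?invr_gt0//.
have : `|f q + (-1) ^+ b *: f (- q)| <= e + e.
  by apply: le_trans (ler_normD _ _) _; rewrite lerD// normrZ normrX normrN1 expr1n mul1r.
by move=> h; lra.
Qed.

Lemma part_sum b N (F : nat -> quat R -> quat R) q :
  part b (fun x => \sum_(n < N) F n x) q = \sum_(n < N) part b (F n) q.
Proof.
rewrite partE scaler_sumr -big_split/= scaler_sumr.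
by apply: eq_bigr => n _; rewrite partE.
Qed.

Lemma part_power b n (c : quat R) q :
  part b (fun x => x ^+ n * c) q = q ^+ n * (if odd n == b then c else 0).
Proof.
rewrite partE [(- q) ^+ n]exprNn -[(-1) ^+ n]signr_odd.
by case: (odd n); case: b; rewrite /= ?expr0 ?expr1 ?mul1r ?mulN1r ?mulNr ?scaleN1r ?scale1r
  ?opprK ?subrr ?scaler0 ?mulr0 ?half_double.
Qed.

Lemma part_psum b a N p :
  part b (fun q => \sum_(n < N) q ^+ n * a n) (s p) = psum I (coef b a) N p.
Proof.
rewrite (part_sum b N (fun n x => x ^+ n * a n)).
by apply: eq_bigr => n _; rewrite part_power.
Qed.

Lemma part_power_series b f a : power_series I (f \o s) a ->
  power_series I (part b f \o s) (coef b a).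
Proof.
move=> fa rho e e0; have [M0 H] := fa rho e e0; exists M0 => M MM p prho.
rewrite -part_psum -partB; apply: norm_part_le; first exact: H.
have := H M MM (- p); rewrite /psum /= sliceN normrN; exact.
Qed.

End parts.

(** * The two weights of the Fock space and the orthonormal basis *)

Section weights.
Variables (R : realType) (I : quat R) (alpha : R).
Hypotheses (hI : imag_sphere I) (a1 : -1 < alpha).
Local Notation mu := (@lebesgue_measure R).
Local Notation s := (slice I).
Implicit Types (b : bool) (p : R * R) (f : quat R -> quat R) (n m : nat).

(* The junk value 0^-1 = 0 at the origin is harmless: the density of index
   alpha + 1 vanishes there. *)
Definition weight b p : R :=
  if b then 2 * (alpha + 1) * ((r2 p)^-1 * fock_density (alpha + 1) (s p))
  else fock_density alpha (s p).

Let al0 : 0 < alpha + 1.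
Proof. by have h := a1; lra. Qed.

Let al1 : -1 < alpha + 1.
Proof. by have h := a1; lra. Qed.

Let c0 : 0 < 2 * (alpha + 1).
Proof. exact: mulr_gt0. Qed.

Lemma weight_ge0 b p : 0 <= weight b p.
Proof.
case: b; rewrite /weight; last exact: fock_density_ge0.
apply: mulr_ge0; first exact: ltW.
by apply: mulr_ge0; [rewrite invr_ge0 r2_ge0|exact: fock_density_ge0].
Qed.

Lemma weight_rotp b t p : weight b (rotp t p) = weight b p.
Proof. by rewrite /weight !fock_density_rotp// (r2_rotp hI). Qed.

Lemma measurable_r2V : measurable_fun setT (fun p => (r2 p)^-1).
Proof.
under eq_fun do rewrite -powR_inv1 ?r2_ge0//.
exact: (measurableT_comp (measurable_powR (-1)) (@measurable_r2 R)).
Qed.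

Lemma measurable_weight b : measurable_fun setT (weight b).
Proof.
case: b; rewrite /weight; last exact: measurable_fock_density.
apply: measurable_funM => //; apply: measurable_funM; first exact: measurable_r2V.
exact: measurable_fock_density.
Qed.

Lemma beta_coef_gt0 n : 0 < beta_coef alpha n.
Proof.
have n0 : 0 <= (n.+1 %/ 2)%:R :> R by exact: ler0n.
by rewrite /beta_coef divr_gt0 ?mulr_gt0 ?exprn_gt0 ?ltr0n ?fact_gt0 ?Gamma_gt0// -addrA
  ltr_wpDl.
Qed.

(** For n = 2 k + 1 the factor |p|^(-2) reduces to the moment of order 2 k at alpha + 1; the factor
    2 (alpha + 1) supplies the last power of 2 and turns 1 / Gamma(alpha + 2) into 1 / Gamma(alpha +
    1). *)
Lemma wmoment_weight n : wmoment (weight (odd n)) n = (beta_coef alpha n)%:E.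
Proof.
rewrite /beta_coef !divn2 -[n.+1./2]/(uphalf n) uphalf_half.
rewrite /wmoment -{2 3}(odd_double_half n) -mul2n; case: (odd n) => /=; last first.
  by rewrite !add0n fock_density_moment.
rewrite !add1n.
transitivity (\int[mu \x mu]_p ((2 * (alpha + 1))%:E *
    (fock_density (alpha + 1) (s p) * r2 p ^+ (2 * n./2))%:E))%E.
  apply: eq_integral => p _; rewrite -EFinM; congr EFin; rewrite -mulrA; congr (_ * _).
  have [r0|r0] := eqVneq (r2 p) 0.
    have ne0 : alpha + 1 + 1 != 0 by rewrite gt_eqF// addr_gt0.
    by rewrite fock_density_slice// r0 powR0// !(mul0r, mulr0).
  by rewrite exprS; field.
have md := measurable_fock_density hI (alpha + 1).
have H0 p : (0 <= (fock_density (alpha + 1) (s p) * r2 p ^+ (2 * n./2))%:E)%E.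
  by rewrite lee_fin mulr_ge0 ?exprn_ge0 ?r2_ge0// fock_density_ge0.
have mH : measurable_fun setT (fun p =>
    (fock_density (alpha + 1) (s p) * r2 p ^+ (2 * n./2))%:E).
  apply/measurable_EFinP; apply: measurable_funM => //.
  by apply: measurable_funX; exact: measurable_r2.
rewrite ge0_integralZl_EFin//; last exact: ltW.
rewrite fock_density_moment//.
rewrite -EFinM; congr EFin.
rewrite (Gamma_recursion al0).
have -> : n./2.+1%:R + alpha + 1 = n./2%:R + (alpha + 1) + 1 :> R.
  by rewrite -natr1; ring.
have G0 : Gamma (alpha + 1) != 0 by rewrite gt_eqF// Gamma_gt0.
have ne0 : alpha + 1 != 0 by rewrite gt_eqF.
by rewrite exprS; field; rewrite ne0 G0.
Qed.

Lemma odd_energy f : qmeasurable (part true f \o s) ->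
  ((2 * (alpha + 1))%:E * slice_integral (alpha + 1) I
     (fun q => `|odd_part f q| ^+ 2 * `|q| ^- 2)%R =
   wnorm (weight true) (part true f \o s))%E.
Proof.
move=> mf; have a0 := measurable_sqr_norm mf.
rewrite /slice_integral -ge0_integralZl_EFin//; last 3 first.
- move=> p _; rewrite lee_fin; apply: mulr_ge0; first exact: fock_density_ge0.
  by rewrite mulr_ge0 ?invr_ge0 ?sqr_ge0.
- apply/measurable_EFinP; apply: measurable_funM; first exact: measurable_fock_density.
  apply: measurable_funM => //.
  by under eq_fun do rewrite sqr_norm_slice_r2//; exact: measurable_r2V.
- exact: ltW.
apply: eq_integral => p _; rewrite -EFinM; congr EFin.
by rewrite sqr_norm_slice_r2// /weight /=; ring.
Qed.

Lemma fock_energyE f : qmeasurable (part true f \o s) ->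
  fock_energy alpha I f =
  (wnorm (weight false) (part false f \o s) + wnorm (weight true) (part true f \o s))%E.
Proof. by move=> mf; rewrite /fock_energy odd_energy. Qed.

Lemma slice_integral0 (a : R) (F : quat R -> R) : (forall q, F q = 0) ->
  slice_integral a I F = 0%E.
Proof. by move=> F0; apply: integral0_eq => p _; rewrite F0 mulr0. Qed.

(** The integrand conj(f) f is the real number |f|^2, so only the real component survives. *)
Lemma fock_inner_diag f : qmeasurable (part true f \o s) ->
  fock_inner alpha I f f =
  (fine (wnorm (weight false) (part false f \o s)) +
   fine (wnorm (weight true) (part true f \o s)))%:A.
Proof.
move=> mf; rewrite -odd_energy// fine_pmull//.
have Ere (a : R) F G : (forall q, F q = G q) -> slice_integral a I F = slice_integral a I G.
  by move=> FG; apply: eq_integral => p _; rewrite FG.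
have E0 : slice_qintegral alpha I (fun q => quat_conj (even_part f q) * even_part f q) =
    (fine (wnorm (weight false) (part false f \o s)))%:A.
  apply: quat_eq => /=; rewrite ?mulr1 ?mulr0.
  - rewrite -[wnorm _ _]/(slice_integral alpha I (fun q => `|even_part f q| ^+ 2)).
    by congr fine; apply: Ere => q; rewrite /comp quat_conj_mul /= mulr1.
  - by rewrite slice_integral0// => q; rewrite /comp quat_conj_mul /= mulr0.
  - by rewrite slice_integral0// => q; rewrite /comp quat_conj_mul /= mulr0.
  - by rewrite slice_integral0// => q; rewrite /comp quat_conj_mul /= mulr0.
have E1 : slice_qintegral (alpha + 1) I
    (fun q => `|q| ^- 2 *: (quat_conj (odd_part f q) * odd_part f q)) =
    (fine (slice_integral (alpha + 1) I (fun q => `|odd_part f q| ^+ 2 * `|q| ^- 2)))%:A.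
  apply: quat_eq; rewrite /= ?mulr1 ?mulr0.
  - by congr fine; apply: Ere => q; rewrite /comp quat_conj_mul /= mulr1 mulrC.
  - by rewrite slice_integral0// => q; rewrite /comp quat_conj_mul /= !mulr0.
  - by rewrite slice_integral0// => q; rewrite /comp quat_conj_mul /= !mulr0.
  - by rewrite slice_integral0// => q; rewrite /comp quat_conj_mul /= !mulr0.
by rewrite /fock_inner E0 E1 scalerA -scalerDl.
Qed.

(** The rotation exchanges the positive and negative parts of h, whose integrals therefore agree. *)
Lemma integral_rotp_opp t (h : R * R -> R) : measurable_fun setT h ->
  (forall p, h (rotp t p) = - h p) -> fine (\int[mu \x mu]_p (h p)%:E)%E = 0.
Proof.
move=> mh ht; have mH : measurable_fun setT (EFin \o h) by exact/measurable_EFinP.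
rewrite integralE.
have -> : (\int[mu \x mu]_p (fun x => (h x)%:E)^\- p =
    \int[mu \x mu]_p (fun x => (h x)%:E)^\+ p)%E.
  rewrite -(ge0_integral_rotp t); last 2 first.
  - exact: measurable_funeneg.
  - by move=> p; exact: funeneg_ge0.
  by apply: eq_integral => p _; rewrite funenegE funeposE ht EFinN oppeK.
(* If both integrals are +oo, their difference is an infinite default value, which [fine] sends to
   0. *)
by case: (integral _ _ _) => [r| |] //=; rewrite subrr.
Qed.

Lemma slice_qintegral_rotp_opp (a t : R) (F : quat R -> quat R) : qmeasurable (F \o s) ->
  (forall p, F (s (rotp t p)) = - F (s p)) -> slice_qintegral a I F = 0.
Proof.
move=> [m1 m2 m3 m4] Ft; have md := measurable_fock_density hI a.
by apply: quat_eq; rewrite /slice_qintegral /= /slice_integral;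
  apply: (@integral_rotp_opp t); rewrite /comp;
  [exact: measurable_funM|move=> p; rewrite Ft fock_density_rotp// -mulrN
  |exact: measurable_funM|move=> p; rewrite Ft fock_density_rotp// -mulrN
  |exact: measurable_funM|move=> p; rewrite Ft fock_density_rotp// -mulrN
  |exact: measurable_funM|move=> p; rewrite Ft fock_density_rotp// -mulrN].
Qed.

Lemma fock_phiE n q : fock_phi alpha n q = q ^+ n * (Num.sqrt (beta_coef alpha n))^-1%:A.
Proof. by rewrite -scalerAr mulr1. Qed.

Definition phi_coef b n : quat R :=
  if odd n == b then (Num.sqrt (beta_coef alpha n))^-1%:A else 0.

Lemma part_phi b n q : part b (fock_phi alpha n) q = q ^+ n * phi_coef b n.
Proof.
rewrite -(part_power b n) partE [RHS]partE !fock_phiE; congr (_ *: (_ + _ *: _)).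
Qed.

Lemma qmeasurable_part_phi b n : qmeasurable (part b (fock_phi alpha n) \o s).
Proof.
rewrite (_ : _ \o _ = fun p => s p ^+ n * phi_coef b n); last first.
  by apply/funext => p /=; rewrite part_phi.
by apply: qmeasurableM; [apply: qmeasurableX; exact: qmeasurable_slice|
  exact: qmeasurable_cst].
Qed.

Lemma sqr_norm_phi_coef b n : `|phi_coef b n| ^+ 2 =
  if odd n == b then (beta_coef alpha n)^-1 else 0.
Proof.
rewrite /phi_coef; case: ifP => _; last by rewrite normr0 expr0n.
rewrite normrZ quat_norm1 mulr1 normfV exprVn real_normK ?num_real//.
by rewrite sqr_sqrtr// ltW// beta_coef_gt0.
Qed.

Lemma wnorm_part_phi b n :
  wnorm (weight b) (part b (fock_phi alpha n) \o s) = ((odd n == b)%:R)%:E.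
Proof.
have E p : (weight b p * `|(part b (fock_phi alpha n) \o s) p| ^+ 2)%:E =
    ((`|phi_coef b n| ^+ 2)%:E * (weight b p * r2 p ^+ n)%:E)%E.
  rewrite -EFinM; congr EFin; rewrite /= part_phi quat_normM quat_normX exprMn exprAC.
  by rewrite sqr_norm_slice_r2//; ring.
rewrite /wnorm; under eq_integral do rewrite E.
rewrite ge0_integralZl_EFin ?sqr_ge0//; last 2 first.
- by move=> p _; rewrite lee_fin mulr_ge0 ?weight_ge0 ?exprn_ge0 ?r2_ge0.
- apply/measurable_EFinP; apply: measurable_funM; first exact: measurable_weight.
  by apply: measurable_funX; exact: measurable_r2.
rewrite sqr_norm_phi_coef; case: eqP => [<-|_]; last by rewrite mul0e.
rewrite -/(wmoment (weight (odd n)) n) wmoment_weight -EFinM mulVf//.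
by rewrite gt_eqF// beta_coef_gt0.
Qed.

Lemma fock_phi_diag n : fock_inner alpha I (fock_phi alpha n) (fock_phi alpha n) = 1.
Proof.
rewrite fock_inner_diag ?wnorm_part_phi; last exact: qmeasurable_part_phi.
by case: (odd n); rewrite /= ?addr0 ?add0r scale1r.
Qed.

Lemma part_phi_rotp b n t p : part b (fock_phi alpha n) (s (rotp t p)) =
  expI I (n%:R * t) * part b (fock_phi alpha n) (s p).
Proof. by rewrite !part_phi slice_rotX// mulrA. Qed.

Lemma fock_phi_ortho m n : m != n ->
  fock_inner alpha I (fock_phi alpha m) (fock_phi alpha n) = 0.
Proof.
(* The phase e^(I(m - n)t) stands between two quaternion factors; this t makes it -1, which is
   central. *)
move=> mn; pose t : R := pi / (m%:R - n%:R).
have tE : - (n%:R * t) + m%:R * t = pi.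
  rewrite /t; field.
  by rewrite subr_eq0 eqr_nat.
have G b p : quat_conj (part b (fock_phi alpha n) (s (rotp t p))) *
      part b (fock_phi alpha m) (s (rotp t p)) =
    - (quat_conj (part b (fock_phi alpha n) (s p)) * part b (fock_phi alpha m) (s p)).
  rewrite !part_phi_rotp quat_conjM (conj_expI hI) -mulrA [X in _ * X]mulrA -expID// tE.
  by rewrite /expI cospi sinpi /slice /= scale0r addr0 scaleN1r mulN1r mulrN.
have mG b : qmeasurable (fun p => quat_conj (part b (fock_phi alpha n) (s p)) *
    part b (fock_phi alpha m) (s p)).
  apply: qmeasurableM; first apply: qmeasurable_conj; exact: qmeasurable_part_phi.
rewrite /fock_inner (@slice_qintegral_rotp_opp alpha t); last 2 first.
- exact: mG false.
- exact: G false.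
rewrite (@slice_qintegral_rotp_opp (alpha + 1) t) ?scaler0 ?addr0//; last first.
  by move=> p; rewrite (G true) norm_rot// scalerN.
have mV : measurable_fun setT (fun p => `|s p| ^- 2).
  by under eq_fun do rewrite sqr_norm_slice_r2//; exact: measurable_r2V.
by have [m1 m2 m3 m4] := mG true; split; exact: measurable_funM.
Qed.

Lemma fock_phi_in_fock n : slice_fock alpha I (fock_phi alpha n).
Proof.
split; first exact: slice_regular_monomial.
rewrite fock_energyE; last exact: qmeasurable_part_phi.
by rewrite !wnorm_part_phi -EFinD ltry.
Qed.

Lemma fock_phi_dense f : slice_fock alpha I f -> forall eps : R, 0 < eps ->
  exists (N : nat) (a : nat -> quat R),
    let g := fun q => f q - \sum_(n < N) fock_phi alpha n q * a n in
    Num.sqrt (q_re (fock_inner alpha I g g)) < eps.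
Proof.
move=> [rf Ef] eps e0; have [a fa] := slice_regular_power_series hI rf.
have pf b : power_series I (part b f \o s) (coef b a) by exact: part_power_series.
have mpf b : qmeasurable (part b f \o s) := power_series_qmeasurable (pf b).
rewrite fock_energyE in Ef; last exact: mpf.
have wn0 b F : (0 <= wnorm (weight b) F)%E.
  by apply: integral_ge0 => p _; rewrite lee_fin mulr_ge0 ?weight_ge0 ?sqr_ge0.
have termE b n : ((`|coef b a n| ^+ 2)%:E * wmoment (weight b) n =
    (if odd n == b then `|a n| ^+ 2 * beta_coef alpha n else 0)%:E)%E.
  rewrite /coef; case: eqP => [<-|_]; first by rewrite wmoment_weight.
  by rewrite normr0 expr0n /= mul0e.
pose u n := `|a n| ^+ 2 * beta_coef alpha n.
have u0 n : 0 <= u n by rewrite mulr_ge0 ?sqr_ge0// ltW// beta_coef_gt0.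
have bessel b M : ((\sum_(n < M) if odd n == b then u n else 0)%:E <=
    wnorm (weight b) (part b f \o s))%E.
  rewrite -sumEFin; under eq_bigr do rewrite -termE.
  exact: (wnorm_bessel hI (weight_ge0 b) (measurable_weight b) (weight_rotp b) M (pf b)).
have uE M : \sum_(n < M) u n <= fine (wnorm (weight false) (part false f \o s) +
    wnorm (weight true) (part true f \o s))%E.
  rewrite -lee_fin fineK; last first.
    by rewrite ge0_fin_numE// adde_ge0.
  apply: le_trans (leeD (bessel false M) (bessel true M)).
  rewrite -EFinD lee_fin -big_split/=; apply: ler_sum => n _.
  by case: (odd n); rewrite /= ?addr0 ?add0r.
(* Each parity contributes at most eps^2 / 4, so the squared distance is at most eps^2 / 2. *)
have d0 : 0 < eps ^+ 2 / 4 by rewrite divr_gt0// exprn_gt0.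
have [N HN] := bounded_series_tail u0 uE d0.
(* The factor undoes the normalization of [fock_phi], so g is f minus its Taylor polynomial. *)
exists N, (fun n => Num.sqrt (beta_coef alpha n) *: a n) => g.
have gE : g = fun q => f q - \sum_(n < N) q ^+ n * a n.
  apply/funext => q; rewrite /g; congr (_ - _); apply: eq_bigr => n _.
  rewrite -scalerAr -scalerAl scalerA mulfV ?scale1r//.
  by rewrite sqrtr_eq0 -ltNge beta_coef_gt0.
have pg b : part b g \o s = fun p => (part b f \o s) p - psum I (coef b a) N p.
  by apply/funext => p; rewrite /= gE partB part_psum.
have mg b : qmeasurable (part b g \o s).
  by rewrite pg; apply: qmeasurableB => //; exact: qmeasurable_psum.
have tail b : fine (wnorm (weight b) (part b g \o s)) <= eps ^+ 2 / 4.
  apply: fine_le_real => //; rewrite pg.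
  apply: (wnorm_tail hI (weight_ge0 b) (measurable_weight b) (weight_rotp b) (pf b)) => M.
  under eq_bigr do rewrite termE.
  rewrite sumEFin lee_fin; apply: le_trans (HN M); apply: ler_sum => n _.
  by case: ifP.
rewrite fock_inner_diag// q_re_scalar.
have := tail false; have := tail true => h1 h2.
have e2 : 0 < eps ^+ 2 by rewrite exprn_gt0.
rewrite -[ltRHS]gtr0_norm// -sqrtr_sqr ltr_sqrt//.
by lra.
Qed.

End weights.

Theorem proposition3p7 (R : realType) (alpha : R) (halpha : - 2^-1 <= alpha)
    (I : quat R) (hI : imag_sphere I) :
  orthonormal_basis (slice_fock alpha I) (fock_inner alpha I)
    (fock_phi alpha).
Proof.
have a1 : -1 < alpha by lra.
split; first exact: fock_phi_in_fock.
- move=> m n; have [->|mn] := eqVneq m n; first exact: fock_phi_diag.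
  exact: fock_phi_ortho.
- exact: fock_phi_dense.
Qed.
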